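(* There is a data-oblivious, cache-agnostic binary fork-join implementation of bitonic sort that can sort $n$ elements in $O(n\log^2 n)$ work, $O(\log^2 n\cdot\log\log n)$ span, and $O((n/B)\cdot\log_M n\cdot\log(n/M))$ cache complexity, when $n>M\ge B^2$, where $M$ is the cache size and $B$ the block size.
   Context: **Bitonic sort.** Batcher's bitonic sorting network on $n$ inputs ($n$ a power of 2): to sort an array in a given direction, recursively sort the first half in that direction and the second half in the opposite direction, then apply a bitonic merge to the concatenation. A bitonic merge of size $m$ consists of $\log_2 m$ layers of comparators: in layer $j=1,\dots,\log_2 m$, the element at index $i$ with $(i \bmod m/2^{j-1})<m/2^{j}$ is compared (and swapped if necessary, according to the direction) with the element at index $i+m/2^{j}$. An implementation of bitonic sort evaluates exactly these comparators. **Binary fork-join model.** A multithreaded computation over a shared memory. Execution starts as a single thread; a thread may fork two tasks that may run in parallel, and the matching join is passed only after both complete. Fork-join pairs are disjoint or nested; synchronization occurs only at joins; no concurrent writes to a location. A $k$-way parallel loop forks $k$ threads as a binary tree of depth $\log_2 k$. **Cost measures.** *Work*: total number of operations. *Span*: length of the longest path in the computation DAG. *Cache complexity*: number of block transfers (cache misses) of the sequential execution with an ideal cache (optimal replacement) of size $M$ and blocks of size $B$. *Cache-agnostic* (cache-oblivious): the algorithm does not use the values $M,B$. **Data-oblivious.** The access pattern, i.e. the computation DAG of forks and joins together with the memory address and read/write type of every access of every thread, can be simulated from the input length $n$ alone; here (deterministic algorithm) this means that the access pattern depends only on $n$.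
   Formalization: Every logarithm in the bounds is read as max(1, log2 x); taken literally, log(n/M) tends to 0 when M is just below n (and log log n = 0 at n = 2), so the stated bounds would fail there. *)

(* Defs.v *)
From HB Require Import structures.
From mathcomp Require Import all_boot all_order all_algebra.
From mathcomp Require Import reals exp.
Set Implicit Arguments.
Unset Strict Implicit.
Unset Printing Implicit Defensive.

(** * Batcher's bitonic sorting network *)

(* The comparator (p, q) puts the minimum on position p and the maximum on
   position q. *)
Definition comparator := (nat * nat)%type.

Definition oriented (up : bool) (i j : nat) : comparator :=
  if up then (i, j) else (j, i).

(* Layer j (from 1 on) of the bitonic merge of the m positions
   base, ..., base + m - 1. *)
Definition merge_layer (up : bool) (base m j : nat) : seq comparator :=
  [seq oriented up (base + i) (base + (i + m %/ 2 ^ j))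
     | i <- iota 0 m & i %% (m %/ 2 ^ j.-1) < m %/ 2 ^ j].

Definition bitonic_merge (up : bool) (base k : nat) : seq comparator :=
  flatten [seq merge_layer up base (2 ^ k) j | j <- iota 1 k].

(* The network on 2 ^ k inputs, as a sequence of comparators compatible with
   the order of the layers. *)
Fixpoint bitonic_sort (up : bool) (base k : nat) : seq comparator :=
  if k is k'.+1 then
    bitonic_sort up base k' ++ bitonic_sort (~~ up) (base + 2 ^ k') k'
      ++ bitonic_merge up base k
  else [::].

(* A wire of a comparator circuit: the i-th input, or the minimum (maximum)
   output of the comparator whose two input wires are given. In a sorting
   network every comparator has its own pair of input wires, so this pair
   identifies the comparator. *)
Inductive wire := Input of nat | MinOut of wire & wire | MaxOut of wire & wire.

Definition wire_eq_dec : comparable wire.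
Proof. by move=> x y; rewrite /decidable; do ![decide equality]. Defined.

HB.instance Definition _ := hasDecEq.Build wire (compareP wire_eq_dec).

Definition gate := (wire * wire)%type.

Definition upd (A : Type) (f : nat -> A) (i : nat) (a : A) : nat -> A :=
  fun j => if j == i then a else f j.

(* The wires at all positions after the network, and the gates evaluated. *)
Fixpoint run_network (net : seq comparator) (w : nat -> wire) :
    (nat -> wire) * seq gate :=
  if net is (p, q) :: net' then
    let: (w', gs) := run_network net'
      (upd (upd w p (MinOut (w p) (w q))) q (MaxOut (w p) (w q))) in
    (w', (w p, w q) :: gs)
  else (w, [::]).

Definition bitonic_wires (k : nat) : nat -> wire :=
  (run_network (bitonic_sort true 0 k) Input).1.

Definition bitonic_gates (k : nat) : seq gate :=
  (run_network (bitonic_sort true 0 k) Input).2.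

(** * Computation DAGs of binary fork-join computations *)

(* Heap cells are shared by all threads; Stack cells hold the frames of calls
   and forks. *)
Inductive loc := Heap of nat | Stack of nat.

Definition loc_eq_dec : comparable loc.
Proof. by move=> x y; rewrite /decidable; do ![decide equality]. Defined.

HB.instance Definition _ := hasDecEq.Build loc (compareP loc_eq_dec).

(* A series-parallel DAG whose nodes are unit-cost operations: an operation
   without memory access, a read or a write of a location, or (two nodes for
   each Par) a fork and the matching join. *)
Inductive dag :=
  | Local
  | Read of loc
  | Write of loc
  | Ser of dag & dag
  | Par of dag & dag.

Fixpoint dag_work (D : dag) : nat :=
  match D with
  | Ser D1 D2 => dag_work D1 + dag_work D2
  | Par D1 D2 => (dag_work D1 + dag_work D2).+2
  | _ => 1
  end.

Fixpoint dag_span (D : dag) : nat :=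
  match D with
  | Ser D1 D2 => dag_span D1 + dag_span D2
  | Par D1 D2 => (maxn (dag_span D1) (dag_span D2)).+2
  | _ => 1
  end.

(* The locations accessed by the sequential execution, in order. *)
Fixpoint accesses (D : dag) : seq loc :=
  match D with
  | Local => [::]
  | Read l | Write l => [:: l]
  | Ser D1 D2 | Par D1 D2 => accesses D1 ++ accesses D2
  end.

Fixpoint writes (D : dag) : seq loc :=
  match D with
  | Local | Read _ => [::]
  | Write l => [:: l]
  | Ser D1 D2 | Par D1 D2 => writes D1 ++ writes D2
  end.

Definition is_heap (l : loc) : bool := if l is Heap _ then true else false.

(* D1 writes no shared location that D2 reads or writes. *)
Definition no_conflict (D1 D2 : dag) : bool :=
  all (fun l => ~~ (is_heap l && (l \in accesses D2))) (writes D1).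

(* Parallel tasks have private stacks (their Stack addresses are those of the
   sequential execution), so only the heap can be subject to races. In a
   race-free DAG all schedules have the same effect as the sequential one. *)
Fixpoint race_free (D : dag) : bool :=
  match D with
  | Ser D1 D2 => race_free D1 && race_free D2
  | Par D1 D2 => [&& race_free D1, race_free D2,
                     no_conflict D1 D2 & no_conflict D2 D1]
  | _ => true
  end.

(** * Ideal cache *)

Definition block (B : nat) (l : loc) : loc :=
  match l with Heap a => Heap (a %/ B) | Stack a => Stack (a %/ B) end.

(* The possible contents of a cache of c blocks after a miss on block b. *)
Definition replacements (c : nat) (C : seq loc) (b : loc) : seq (seq loc) :=
  if size C < c then [:: b :: C] else [seq b :: rem e C | e <- C].

(* The least number of misses, over all replacement choices, when the blocks
   of s are requested in order and the cache contains C. The neutral element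
   [size s'] of the minimum is an upper bound on the number of misses on s'. *)
Fixpoint opt_misses (c : nat) (C : seq loc) (s : seq loc) : nat :=
  if s is b :: s' then
    if b \in C then opt_misses c C s'
    else (\big[minn/size s']_(C' <- replacements c C b) opt_misses c C' s').+1
  else 0.

Definition cache_misses (M B : nat) (D : dag) : nat :=
  opt_misses (M %/ B) [::] [seq block B l | l <- accesses D].

(** * A fork-join random access machine *)

Inductive binop := Add | Sub | Mul | Div | Mod | Shl | Shr | Leq | Eq.

Definition binop_sem (o : binop) (a b : nat) : nat :=
  match o with
  | Add => a + b
  | Sub => a - b
  | Mul => a * b
  | Div => a %/ b
  | Mod => a %% b
  | Shl => a * 2 ^ b
  | Shr => a %/ 2 ^ b
  | Leq => a <= b
  | Eq => a == b
  end.

Inductive expr := Const of nat | Reg of nat | Bin of binop & expr & expr.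

(* [Fetch r e] and [Store e r] access the heap cell of address e. [Comp r1 r2 f]
   is the only operation on elements besides copying: it leaves the minimum of
   the elements in registers r1 and r2 in r1, the maximum in r2, and in
   register f whether they were swapped, on which the program may branch.
   [Call p] runs procedure p, and [Fork c1 c2] forks the tasks c1 and c2, on
   copies of the registers of the caller, which are restored at the return or
   join; results are communicated through the heap. *)
Inductive com :=
  | Skip
  | Assign of nat & expr
  | Move of nat & nat
  | Fetch of nat & expr
  | Store of expr & nat
  | Comp of nat & nat & nat
  | Seq of com & com
  | If of expr & com & com
  | Call of nat
  | Fork of com & com.

(* The list of the procedures; the main one has index 0. *)
Definition program := seq com.

Fixpoint expr_size (e : expr) : nat :=
  if e is Bin _ e1 e2 then (expr_size e1 + expr_size e2).+1 else 1.

(* A strict bound on the indices of the registers that occur. *)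
Fixpoint expr_regs (e : expr) : nat :=
  match e with
  | Const _ => 0
  | Reg r => r.+1
  | Bin _ e1 e2 => maxn (expr_regs e1) (expr_regs e2)
  end.

Fixpoint com_regs (c : com) : nat :=
  match c with
  | Skip | Call _ => 0
  | Assign r e | Fetch r e | Store e r => maxn r.+1 (expr_regs e)
  | Move r s => maxn r.+1 s.+1
  | Comp r1 r2 f => maxn (maxn r1.+1 r2.+1) f.+1
  | Seq c1 c2 | Fork c1 c2 => maxn (com_regs c1) (com_regs c2)
  | If e c1 c2 => maxn (expr_regs e) (maxn (com_regs c1) (com_regs c2))
  end.

(* A frame holds all the registers and a return address. *)
Definition frame_size (P : program) : nat :=
  (\max_(c <- P) com_regs c).+1.

Definition frame (P : program) (d : nat) : seq loc :=
  [seq Stack i | i <- iota (d * frame_size P) (frame_size P)].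

Definition save_frame (P : program) (d : nat) : dag :=
  foldr Ser Local [seq Write l | l <- frame P d].

Definition restore_frame (P : program) (d : nat) : dag :=
  foldr Ser Local [seq Read l | l <- frame P d].

(* The DAG of the evaluation of an expression. *)
Definition eval_dag (e : expr) : dag := iter (expr_size e).-1 (Ser Local) Local.

(* A value is a word or an element of the array being sorted. The wire of an
   element is a ghost: no operation of the machine depends on it, it only
   records through which comparators the element went. *)
Inductive value (T : Type) := Word of nat | Elem of T & wire.
Arguments Word {T}.

Definition bounded (W v : nat) : option nat := if v < W then Some v else None.

(* Evaluation traps on words that are not smaller than W, and on elements. *)
Fixpoint eval (T : Type) (W : nat) (rho : nat -> value T) (e : expr) :
    option nat :=
  match e with
  | Const v => bounded W v
  | Reg r => if rho r is Word v then bounded W v else None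
  | Bin o e1 e2 =>
      if (eval W rho e1, eval W rho e2) is (Some v1, Some v2)
      then bounded W (binop_sem o v1 v2) else None
  end.

(* [exec W P d c rho mu rho' mu' D gs]: at stack depth d, the sequential
   execution of c from the registers rho and the heap mu ends in rho' and mu',
   has the computation DAG D, and evaluates the comparators gs. *)
Inductive exec (disp : Order.disp_t) (T : orderType disp) (W : nat)
    (P : program) : nat -> com ->
    (nat -> value T) -> (nat -> value T) ->
    (nat -> value T) -> (nat -> value T) -> dag -> seq gate -> Prop :=
  | exec_skip d rho mu :
      exec W P d Skip rho mu rho mu Local [::]
  | exec_set d r e v rho mu :
      eval W rho e = Some v ->
      exec W P d (Assign r e) rho mu (upd rho r (Word v)) mu
        (Ser (eval_dag e) Local) [::]
  | exec_move d r s rho mu :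
      exec W P d (Move r s) rho mu (upd rho r (rho s)) mu Local [::]
  | exec_load d r e a rho mu :
      eval W rho e = Some a ->
      exec W P d (Fetch r e) rho mu (upd rho r (mu a)) mu
        (Ser (eval_dag e) (Read (Heap a))) [::]
  | exec_store d e r a rho mu :
      eval W rho e = Some a ->
      exec W P d (Store e r) rho mu rho (upd mu a (rho r))
        (Ser (eval_dag e) (Write (Heap a))) [::]
  | exec_comp d r1 r2 f x1 g1 x2 g2 rho mu :
      rho r1 = Elem x1 g1 -> rho r2 = Elem x2 g2 ->
      exec W P d (Comp r1 r2 f) rho mu
        (upd (upd (upd rho r1 (Elem (Order.min x1 x2) (MinOut g1 g2)))
                  r2 (Elem (Order.max x1 x2) (MaxOut g1 g2)))
             f (Word (x2 < x1)%O)) mu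
        Local [:: (g1, g2)]
  | exec_seq d c1 c2 rho mu rho1 mu1 D1 gs1 rho2 mu2 D2 gs2 :
      exec W P d c1 rho mu rho1 mu1 D1 gs1 ->
      exec W P d c2 rho1 mu1 rho2 mu2 D2 gs2 ->
      exec W P d (Seq c1 c2) rho mu rho2 mu2 (Ser D1 D2) (gs1 ++ gs2)
  | exec_if d e c1 c2 v rho mu rho' mu' D gs :
      eval W rho e = Some v ->
      exec W P d (if v != 0 then c1 else c2) rho mu rho' mu' D gs ->
      exec W P d (If e c1 c2) rho mu rho' mu'
        (Ser (eval_dag e) (Ser Local D)) gs
  | exec_call d p rho mu rho' mu' D gs :
      exec W P d.+1 (nth Skip P p) rho mu rho' mu' D gs ->
      exec W P d (Call p) rho mu rho mu'
        (Ser (save_frame P d) (Ser D (restore_frame P d))) gs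
  | exec_fork d c1 c2 rho mu rho1 mu1 D1 gs1 rho2 mu2 D2 gs2 :
      exec W P d.+1 c1 rho mu rho1 mu1 D1 gs1 ->
      exec W P d.+1 c2 rho mu1 rho2 mu2 D2 gs2 ->
      exec W P d (Fork c1 c2) rho mu rho mu2
        (Ser (save_frame P d)
          (Ser (Par D1 (Ser (restore_frame P d) D2)) (restore_frame P d)))
        (gs1 ++ gs2).

Lemma exec_det (disp : Order.disp_t) (T : orderType disp) W P d c
    (rho mu rho1 mu1 rho2 mu2 : nat -> value T) D1 gs1 D2 gs2 :
  exec W P d c rho mu rho1 mu1 D1 gs1 ->
  exec W P d c rho mu rho2 mu2 D2 gs2 ->
  [/\ rho1 = rho2, mu1 = mu2, D1 = D2 & gs1 = gs2].
Proof.
move=> H; elim: H rho2 mu2 D2 gs2 => {d c rho mu rho1 mu1 D1 gs1}.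
- by move=> d rho mu r' m' D' g' E; inversion E.
- move=> d r e v rho mu Hv r' m' D' g' E.
  by inversion E; subst; split; congruence.
- by move=> d r s rho mu r' m' D' g' E; inversion E.
- move=> d r e a rho mu Ha r' m' D' g' E.
  by inversion E; subst; split; congruence.
- move=> d e r a rho mu Ha r' m' D' g' E.
  by inversion E; subst; split; congruence.
- move=> d r1 r2 f x1 g1 x2 g2 rho mu H1 H2 r' m' D' g' E.
  inversion E as [| | | | |? ? ? ? y1 h1 y2 h2 ? ? E1 E2| | | |]; subst.
  move: E1 E2; rewrite H1 H2 => -[<- <-] [<- <-]; by split.
- move=> d c1 c2 rho mu rho1 mu1 D1 gs1 rho2 mu2 D2 gs2 _ IH1 _ IH2 r' m' D' g'.
  move=> E; inversion E as [| | | | | |? ? ? ? ? ? ? ? ? ? ? ? ? E1 E2| | |].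
  subst; have [? ? ? ?] := IH1 _ _ _ _ E1; subst.
  by have [-> -> -> ->] := IH2 _ _ _ _ E2.
- move=> d e c1 c2 v rho mu rho' mu' D gs Hv _ IH r' m' D' g' E.
  inversion E as [| | | | | | |? ? ? ? v' ? ? ? ? ? ? Hv' E1| |]; subst.
  move: Hv' E1; rewrite Hv => -[<-] E1.
  by have [-> -> -> ->] := IH _ _ _ _ E1.
- move=> d p rho mu rho' mu' D gs _ IH r' m' D' g' E.
  inversion E as [| | | | | | | |? ? ? ? ? ? ? ? E1|]; subst.
  by have [_ -> -> ->] := IH _ _ _ _ E1.
move=> d c1 c2 rho mu rho1 mu1 D1 gs1 rho2 mu2 D2 gs2 _ IH1 _ IH2 r' m' D' g' E.
inversion E as [| | | | | | | | |? ? ? ? ? ? ? ? ? ? ? ? ? E1 E2]; subst.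
have [_ ? ? ?] := IH1 _ _ _ _ E1; subst.
by have [_ -> -> ->] := IH2 _ _ _ _ E2.
Qed.

(* The input is in the heap cells 0, ..., n - 1, and register 0 contains n. *)
Definition init_regs (T : Type) (n : nat) : nat -> value T :=
  fun r => Word (if r == 0 then n else 0).

Definition init_heap (T : Type) (x : seq T) : nat -> value T :=
  fun a => if onth x a is Some v then Elem v (Input a) else Word 0.

(* On inputs of length n words are smaller than (n + 1) ^ w, that is, they
   consist of O(log n) bits. *)
Definition run (disp : Order.disp_t) (T : orderType disp) (P : program)
    (w n : nat) (x : n.-tuple T) (mu : nat -> value T) (D : dag)
    (gs : seq gate) : Prop :=
  exists rho, exec (n.+1 ^ w) P 0 (nth Skip P 0)
    (init_regs T n) (init_heap x) rho mu D gs.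

(** * Properties of programs *)

Definition sorts (P : program) (w : nat) : Prop :=
  forall (k : nat) (disp : Order.disp_t) (T : orderType disp)
    (x : (2 ^ k).-tuple T),
  exists mu D gs (y : (2 ^ k).-tuple T),
    [/\ run P w x mu D gs,
        forall i : 'I_(2 ^ k), exists g, mu i = Elem (tnth y i) g,
        sorted <=%O y & perm_eq y x].

(* The comparators evaluated are exactly those of the bitonic sorting network,
   and the i-th output is that of the network. *)
Definition implements_bitonic_sort (P : program) (w : nat) : Prop :=
  forall (k : nat) (disp : Order.disp_t) (T : orderType disp)
    (x : (2 ^ k).-tuple T) mu D gs,
  run P w x mu D gs ->
  perm_eq gs (bitonic_gates k) /\
  forall i : 'I_(2 ^ k), exists v, mu i = Elem v (bitonic_wires k i).

Definition without_races (P : program) (w : nat) : Prop :=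
  forall (k : nat) (disp : Order.disp_t) (T : orderType disp)
    (x : (2 ^ k).-tuple T) mu D gs,
  run P w x mu D gs -> race_free D.

Definition data_oblivious (P : program) (w : nat) : Prop :=
  forall (k : nat) (disp1 disp2 : Order.disp_t)
    (T1 : orderType disp1) (T2 : orderType disp2)
    (x1 : (2 ^ k).-tuple T1) (x2 : (2 ^ k).-tuple T2)
    mu1 D1 gs1 mu2 D2 gs2,
  run P w x1 mu1 D1 gs1 -> run P w x2 mu2 D2 gs2 -> D1 = D2.

(* D is the computation DAG of P on some input of length n. *)
Definition dag_of (P : program) (w n : nat) (D : dag) : Prop :=
  exists (disp : Order.disp_t) (T : orderType disp) (x : n.-tuple T) mu gs,
    run P w x mu D gs.

Local Open Scope ring_scope.

(* The usual convention in asymptotic bounds: logarithms are at least 1. *)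
Definition lg (R : realType) (x : R) : R := Num.max 1 (ln x / ln 2%:R).

(* Main.v *)
(** The program sorts in place; its point is the order in which the comparators
    of a merge are evaluated. A layer of a merge of 2 ^ k positions compares
    positions that differ in one bit, so the layers at the bits in a set commute
    with fixing all the other bits. To apply the layers at h consecutive bits we
    apply those at the upper half of the bits, for all values of the lower half
    in parallel, and then those at the lower half, for all values of the upper
    half. This recursion has span O(h log h), and O(k log k) for the merge.

    A subproblem with few positions may be spread over as many memory blocks, so
    w low order bits are left free too, and 2 ^ w adjacent positions are treated
    together. The width 2 ^ w is halved only when w exceeds 3 h. So when the
    2 ^ (w + h) positions of a subproblem first fit into the cache, 2 ^ w is at
    least of order sqrt M >= B and h is of order log M: such a subproblem loads
    O(2 ^ (w + h) / B) blocks and does h layers, and a merge that does not fit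
    costs O((2 ^ k / B) (k / log M)) misses. In the sort this is paid at the
    log (n / M) levels of the recursion that do not fit into the cache.

    A comparator is identified by the wires that enter it, and both the network
    and the program are compared with the functional description of the layers
    (computes), which does not depend on the order of evaluation. *)

Require Import Defs.
From mathcomp Require Import all_boot all_order all_algebra.
From mathcomp Require Import reals exp.
From mathcomp Require Import zify ring lra.
Import Order.TTheory GRing.Theory Num.Theory.
Set Implicit Arguments.
Unset Strict Implicit.
Unset Printing Implicit Defensive.
Local Open Scope nat_scope.

(** * Bits and cubes *)

Definition bit (b i : nat) : bool := odd (i %/ 2 ^ b).

Definition flip (b i : nat) : nat := if bit b i then i - 2 ^ b else i + 2 ^ b.

Lemma expn2_gt0 x : 0 < 2 ^ x.
Proof. by rewrite expn_gt0. Qed.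

(** Adding 2 ^ f to a number whose bit [f] is 0 produces no carry, so no other bit changes. *)
Lemma bit_add b f i : ~~ bit f i -> bit b (i + 2 ^ f) = (b == f) || bit b i.
Proof.
rewrite /bit => fi; have p2 := expn2_gt0.
have [bf|fb|->] := ltngtP b f.
- rewrite -(subnK (ltnW bf)) expnD divnDMl // oddD oddX /=.
  by rewrite orbF subn_eq0 leqNgt bf addbF.
- rewrite -(subnKC fb) expnD !divnMA; congr (odd (_ %/ _)).
  rewrite expnSr !divnMA -{1}[2 ^ f]mul1n divnDMl //.
  by move: fi; set q := i %/ 2 ^ f; lia.
by rewrite /= -{1}[2 ^ f]mul1n divnDMl // addn1 /= fi.
Qed.

Lemma bit_add_self b i : ~~ bit b i -> bit b (i + 2 ^ b).
Proof. by move=> bi; rewrite bit_add // eqxx. Qed.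

(** After division by 2 ^ f the bound is even and so is the quotient of [i], which can therefore
    grow by one without reaching the bound. *)
Lemma ltn_add_bit f k i : f < k -> i < 2 ^ k -> ~~ bit f i -> i + 2 ^ f < 2 ^ k.
Proof.
rewrite /bit => fk ik fi; have p2 := expn2_gt0.
have e : 2 ^ k = 2 * 2 ^ (k - f.+1) * 2 ^ f.
  by rewrite -expnS -expnD; congr (_ ^ _); lia.
move: ik; rewrite e -!(ltn_divLR _ _ (p2 f)) divnDr ?dvdnn // divnn p2 addn1.
by move: fi; set q := i %/ _; set r := 2 ^ _; lia.
Qed.

(* When clear k fs base holds, these are the numbers that agree with base
   outside the bits fs. *)
Fixpoint cube (fs : seq nat) (base : nat) : seq nat :=
  if fs is f :: fs' then cube fs' base ++ cube fs' (base + 2 ^ f)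
  else [:: base].

Definition clear (k : nat) (fs : seq nat) (base : nat) : bool :=
  [&& uniq fs, all (fun f => (f < k) && ~~ bit f base) fs & base < 2 ^ k].

Lemma clear_cons k f fs base : clear k (f :: fs) base ->
  clear k fs base && clear k fs (base + 2 ^ f).
Proof.
case/and3P=> /= /andP[ffs ufs] /andP[/andP[fk fb] /allP fsb] bk.
rewrite /clear ufs bk ltn_add_bit //= andbT; apply/andP; split; first exact/allP.
rewrite andbT; apply/allP => g gfs; have /andP[-> gb] := fsb _ gfs.
by rewrite bit_add // negb_or gb andbT; apply: contraNneq ffs => <-.
Qed.

Lemma clear_perm k fs fs' base : perm_eq fs fs' -> clear k fs base = clear k fs' base.
Proof. by move=> p; rewrite /clear (perm_uniq p) (perm_all _ p). Qed.

(** The order of branching on the free bits is immaterial. This relates the different ways in which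
    the program splits one subproblem. *)
Lemma cube_perm fs fs' base : perm_eq fs fs' ->
  perm_eq (cube fs base) (cube fs' base).
Proof.
have front f s1 : forall s2 b,
    perm_eq (cube (f :: s1 ++ s2) b) (cube (s1 ++ f :: s2) b).
  elim: s1 => // g s1 IH s2 b; rewrite /= -!catA.
  apply: perm_trans (perm_cat (IH s2 b) (IH s2 (b + 2 ^ g))); rewrite /= -!catA.
  by rewrite perm_cat2l perm_catCA addnAC perm_refl.
elim: fs fs' base => [|f fs IH] fs' base.
  by move/perm_size/esym/size0nil=> ->.
move=> p; have /splitPr def_fs' : f \in fs' by rewrite -(perm_mem p) mem_head.
case: def_fs' p => s1 s2; rewrite -cat1s -[_ :: s2]cat1s => p.
have {}p : perm_eq fs (s1 ++ s2).
  by rewrite -(perm_cat2l [:: f]) (perm_trans p) // perm_catCA.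
by apply: perm_trans (front _ _ _ _); rewrite /= perm_cat // IH.
Qed.

Lemma cube_shift fs base c : cube fs (base + c) = [seq i + c | i <- cube fs base].
Proof.
elim: fs base => //= f fs IH base.
by rewrite map_cat -!IH addnAC.
Qed.

Lemma cube_bit k fs base b i : clear k fs base -> b \notin fs ->
  i \in cube fs base -> bit b i = bit b base.
Proof.
elim: fs base => [|f fs IH] base clr; first by rewrite inE => _ /eqP->.
have /andP[c1 c2] := clear_cons clr.
rewrite inE negb_or => /andP[bf bfs] /=.
rewrite mem_cat => /orP[/IH->//|/IH->//]; rewrite bit_add ?(negbTE bf) //.
by case/and3P: clr => _ /andP[/andP[]].
Qed.

Lemma cube_lt k fs base i : clear k fs base -> i \in cube fs base -> i < 2 ^ k.
Proof.
elim: fs base => [|f fs IH] base clr /=.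
  by rewrite inE => /eqP->; case/and3P: clr.
have /andP[c1 c2] := clear_cons clr.
by rewrite mem_cat => /orP[/IH->|/IH->].
Qed.

(** With [b] moved to the front the cube consists of two halves, which the flip exchanges. *)
Lemma cube_flip k fs base b i : clear k fs base -> b \in fs ->
  i \in cube fs base -> flip b i \in cube fs base.
Proof.
move=> clr /perm_to_rem p.
rewrite !(perm_mem (cube_perm base p)); move: clr; rewrite (clear_perm _ _ p).
set fs' := rem b fs => clr; have /andP[c1 c2] := clear_cons clr.
case/and3P: clr => /= /andP[bfs _] /andP[/andP[_ bb] _] _.
rewrite !mem_cat /flip => /orP[] ib.
  rewrite (cube_bit c1 bfs ib) (negbTE bb) cube_shift.
  by apply/orP; right; apply/mapP; exists i.
rewrite (cube_bit c2 bfs ib) bit_add_self //.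
by move: ib; rewrite cube_shift => /mapP[j jb ->]; rewrite addnK jb.
Qed.

Lemma cube_disjoint k f fs base i : clear k (f :: fs) base ->
  i \in cube fs base -> i \notin cube fs (base + 2 ^ f).
Proof.
move=> clr; have /andP[c1 c2] := clear_cons clr.
case/and3P: clr => /= /andP[ffs _] /andP[/andP[_ fb] _] _ i1.
apply: contraTN isT => i2; move: (cube_bit c1 ffs i1).
by rewrite (cube_bit c2 ffs i2) bit_add_self // (negbTE fb).
Qed.

Lemma cube_iota w base : perm_eq (cube (iota 0 w) base) (iota base (2 ^ w)).
Proof.
elim: w base => // w IH base.
have p : perm_eq (iota 0 w.+1) (w :: iota 0 w).
  by rewrite -addn1 iotaD add0n perm_catC.
apply: perm_trans (cube_perm base p) _.
by rewrite /= expnS mul2n -addnn iotaD perm_cat.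
Qed.

Lemma clear_iota w base : 2 ^ w %| base -> forall k, w <= k -> base < 2 ^ k ->
  clear k (iota 0 w) base.
Proof.
move=> /dvdnP[q ->] k wk bk; apply/and3P; split => //; first exact: iota_uniq.
apply/allP => f; rewrite mem_iota /= add0n => fw; rewrite (leq_trans fw) //=.
rewrite /bit -(subnK (ltnW fw)) expnD mulnA mulnK ?expn2_gt0 //.
by rewrite oddM oddX subn_eq0 leqNgt fw andbF.
Qed.

(** * Networks *)

Notation wires_after net w := (run_network net w).1.
Notation gates_of net w := (run_network net w).2.

Definition comp_step (pq : comparator) (w : nat -> wire) : nat -> wire :=
  upd (upd w pq.1 (MinOut (w pq.1) (w pq.2))) pq.2 (MaxOut (w pq.1) (w pq.2)).

Lemma run_network_cons pq net w :
  run_network (pq :: net) w =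
  (wires_after net (comp_step pq w),
   (w pq.1, w pq.2) :: gates_of net (comp_step pq w)).
Proof. by case: pq => p q /=; case: run_network. Qed.

Lemma run_network_cat net1 net2 w :
  run_network (net1 ++ net2) w =
  (wires_after net2 (wires_after net1 w),
   gates_of net1 w ++ gates_of net2 (wires_after net1 w)).
Proof.
elim: net1 w => [|pq net1 IH] w; first by case: run_network.
by rewrite cat_cons !run_network_cons IH.
Qed.

Lemma wires_after_cat net1 net2 w :
  wires_after (net1 ++ net2) w = wires_after net2 (wires_after net1 w).
Proof. by rewrite run_network_cat. Qed.

Lemma eq_comp_step pq w w' : w =1 w' -> comp_step pq w =1 comp_step pq w'.
Proof. by move=> e i; rewrite /comp_step /upd !e. Qed.

Lemma eq_run_network net w w' : w =1 w' ->
  wires_after net w =1 wires_after net w' /\ gates_of net w = gates_of net w'.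
Proof.
elim: net w w' => [|pq net IH] w w' e //.
have [e1 e2] := IH _ _ (eq_comp_step pq e).
by rewrite !run_network_cons /= !e e2.
Qed.

(** * Equivalence of networks, and their description by layers *)

Definition equiv_nets (net net' : seq comparator) : Prop := forall w,
  wires_after net w =1 wires_after net' w /\
  perm_eq (gates_of net w) (gates_of net' w).

Lemma equiv_nets_cat n1 n2 n1' n2' :
  equiv_nets n1 n1' -> equiv_nets n2 n2' -> equiv_nets (n1 ++ n2) (n1' ++ n2').
Proof.
move=> e1 e2 w; rewrite !run_network_cat /=.
have [w1 g1] := e1 w; have [w2 g2] := eq_run_network n2 w1.
have [w3 g3] := e2 (wires_after n1' w).
split; first by move=> i; rewrite w2 w3.
by rewrite perm_cat // g2.
Qed.

(* The comparators between i and i + 2 ^ b, for all positions i at once. *)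
Definition layer (up : bool) (b : nat) (w : nat -> wire) (i : nat) : wire :=
  if bit b i (+) up then MinOut (w i) (w (flip b i))
  else MaxOut (w (flip b i)) (w i).

Definition layers (up : bool) (bs : seq nat) (w : nat -> wire) : nat -> wire :=
  foldl (fun w b => layer up b w) w bs.

Definition layer_gate (up : bool) (b : nat) (w : nat -> wire) (i : nat) : gate :=
  let: (p, q) := oriented up i (flip b i) in (w p, w q).

Fixpoint layers_count (r : seq nat) (up : bool) (bs : seq nat)
    (w : nat -> wire) (a : pred gate) : nat :=
  if bs is b :: bs' then
    \sum_(i <- r | ~~ bit b i) a (layer_gate up b w i)
      + layers_count r up bs' (layer up b w) a
  else 0.

(* Gates are only counted, since the nets to be compared evaluate disjoint
   comparators in different orders. *)
Definition computes (net : seq comparator) (r : seq nat) (up : bool)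
    (bs : seq nat) : Prop := forall w,
  wires_after net w =1 (fun i => if i \in r then layers up bs w i else w i) /\
  forall a, count a (gates_of net w) = layers_count r up bs w a.

Definition closed_under (r : seq nat) (b : nat) : Prop :=
  {in r, forall i, flip b i \in r}.

Lemma layer_local r up b w w' : closed_under r b ->
  {in r, w =1 w'} -> {in r, layer up b w =1 layer up b w'}.
Proof. by move=> cl e i ir; rewrite /layer !e // cl. Qed.

Lemma layers_local r up bs w w' : {in bs, forall b, closed_under r b} ->
  {in r, w =1 w'} -> {in r, layers up bs w =1 layers up bs w'}.
Proof.
elim: bs w w' => [|b bs IH] w w' cl e //=; apply: IH.
  by move=> c cbs; apply: cl; rewrite inE cbs orbT.
by apply: layer_local => //; apply: cl; rewrite mem_head.
Qed.

Lemma layers_count_local r up bs w w' a : {in bs, forall b, closed_under r b} ->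
  {in r, w =1 w'} -> layers_count r up bs w a = layers_count r up bs w' a.
Proof.
elim: bs w w' => [|b bs IH] w w' cl e //=.
have clb : closed_under r b by apply: cl; rewrite mem_head.
congr (_ + _); last first.
  apply: IH; last exact: layer_local.
  by move=> c cbs; apply: cl; rewrite inE cbs orbT.
rewrite big_seq_cond [RHS]big_seq_cond; apply: eq_bigr => i /andP[ir _].
by rewrite /layer_gate; case: (up); rewrite /= !e // clb.
Qed.

(** A layer on a closed set reads only wires of that set, so it is enough for the second network
    that its initial wires are right on [r]. *)
Lemma computes_seq net1 net2 r up bs1 bs2 : {in bs2, forall b, closed_under r b} ->
  computes net1 r up bs1 -> computes net2 r up bs2 ->
  computes (net1 ++ net2) r up (bs1 ++ bs2).
Proof.
move=> cl c1 c2 w; rewrite run_network_cat /=.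
have [w1 g1] := c1 w; have [w2 g2] := c2 (wires_after net1 w).
have e : {in r, wires_after net1 w =1 layers up bs1 w}.
  by move=> i ir; rewrite w1 ir.
split=> [i | a].
  rewrite w2; case: ifP => ir; last by rewrite w1 ir.
  by rewrite (layers_local _ cl e) // /layers foldl_cat.
rewrite count_cat g1 g2 (layers_count_local _ _ cl e).
elim: bs1 w {c1 w1 g1 w2 g2 e} => //= b bs1 IH w.
by rewrite -addnA IH.
Qed.

(** Neither network touches positions of the other, so evaluating one completely before the other
    has the effect of whole layers on the union. *)
Lemma computes_union net1 net2 r1 r2 up bs :
  {in bs, forall b, closed_under r1 b} -> {in bs, forall b, closed_under r2 b} ->
  {in r1, forall i, i \notin r2} ->
  computes net1 r1 up bs -> computes net2 r2 up bs ->
  computes (net1 ++ net2) (r1 ++ r2) up bs.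
Proof.
move=> cl1 cl2 dis c1 c2 w; rewrite run_network_cat /=.
have [w1 g1] := c1 w; have [w2 g2] := c2 (wires_after net1 w).
have e : {in r2, wires_after net1 w =1 w}.
  by move=> i ir; rewrite w1; case: ifP => // /dis; rewrite ir.
split=> [i | a].
  rewrite w2 mem_cat; case: ifP => ir; first by rewrite (layers_local _ cl2 e) // orbT.
  by rewrite w1 orbF.
rewrite count_cat g1 g2 (layers_count_local _ _ cl2 e) {c1 c2 w1 w2 g1 g2 e}.
by elim: bs w {cl1 cl2} => //= b bs IH w; rewrite -IH big_cat addnACA.
Qed.

Lemma computes_perm net r r' up bs :
  perm_eq r r' -> computes net r up bs -> computes net r' up bs.
Proof.
move=> p c w; have [e g] := c w; split=> [i | a].
  by rewrite e (perm_mem p).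
by rewrite g; elim: bs w {c e g} => //= b bs IH w; rewrite IH (perm_big _ p).
Qed.

Lemma computes_comparator up b i : ~~ bit b i ->
  computes [:: oriented up i (i + 2 ^ b)] [:: i; i + 2 ^ b] up [:: b].
Proof.
move=> bi w; have bj := bit_add_self bi.
have ij : (i == i + 2 ^ b) = false by have := expn2_gt0 b; lia.
have fi : flip b i = i + 2 ^ b by rewrite /flip (negbTE bi).
have fj : flip b (i + 2 ^ b) = i by rewrite /flip bj addnK.
split=> [j | a].
  rewrite run_network_cons /comp_step /upd /= !inE /layer.
  case: (eqVneq j i) => [-> | ji].
    rewrite (negbTE bi) fi; case: up; rewrite /= ?eqxx ?ij //.
  case: (eqVneq j (i + 2 ^ b)) => [-> | jj]; last first.
    by case: up; rewrite /= (negbTE ji) (negbTE jj).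
  by rewrite bj fj; case: up; rewrite /= ?eqxx // ?[_ == i]eq_sym ij.
rewrite run_network_cons /= !big_cons big_nil bi bj /= /layer_gate fi.
by case: up; rewrite /= !addn0.
Qed.

Lemma computes_nil up bs : computes [::] [::] up bs.
Proof.
by move=> w; split=> // a /=; elim: bs w => //= b bs IH w; rewrite -IH big_nil.
Qed.

(** Equal counts for all predicates mean equal multisets of gates. *)
Lemma computes_equiv net net' r up bs :
  computes net r up bs -> computes net' r up bs -> equiv_nets net net'.
Proof.
move=> c c' w; have [e g] := c w; have [e' g'] := c' w; split=> [i | ].
  by rewrite e e'.
by apply/permP => a; rewrite g g'.
Qed.


(** * The bitonic network *)

Definition low_end (b i : nat) : nat := if bit b i then i - 2 ^ b else i.

Lemma bit_ge b i : bit b i -> 2 ^ b <= i.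
Proof.
by rewrite /bit leqNgt; apply: contraL => ib; rewrite divn_small.
Qed.

Lemma bit_low_end b i : ~~ bit b (low_end b i).
Proof.
rewrite /low_end; case: ifPn => // bi.
rewrite /bit -{1}[2 ^ b]mul1n divnBMl.
by move: bi; rewrite /bit; lia.
Qed.

(** The comparators act on disjoint pairs and are joined by [computes_union]; the last clause
    identifies the pair of a position by its lower end. *)
Lemma computes_layer up b s : uniq s -> {in s, forall i, ~~ bit b i} ->
  let r := flatten [seq [:: i; i + 2 ^ b] | i <- s] in
  [/\ computes [seq oriented up i (i + 2 ^ b) | i <- s] r up [:: b],
      uniq r & forall j, (j \in r) = (low_end b j \in s)].
Proof.
elim: s => [_ _ | i s IH /= /andP[i_s us] low]; first by split=> //; exact: computes_nil.
have bi : ~~ bit b i by rewrite low ?mem_head.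
have {IH}[|c u mem] := IH us; first by move=> j js; rewrite low // inE js orbT.
set r := flatten _ in c u mem *.
have li : low_end b i = i by rewrite /low_end (negbTE bi).
have bj := bit_add_self bi.
have lj : low_end b (i + 2 ^ b) = i by rewrite /low_end bj addnK.
have ij : (i == i + 2 ^ b) = false by have := expn2_gt0 b; lia.
have memc j : (j \in [:: i, i + 2 ^ b & r]) = (low_end b j \in i :: s).
  rewrite !inE -mem orbA; congr (_ || _); apply/orP/eqP => [[]/eqP-> // | <-].
  rewrite /low_end; case: ifPn => [/bit_ge h | _]; last by left.
  by right; rewrite subnK.
have flipi : flip b i = i + 2 ^ b by rewrite /flip (negbTE bi).
have flipj : flip b (i + 2 ^ b) = i by rewrite /flip bj addnK.
have lflip j : low_end b (flip b j) = low_end b j.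
  rewrite /flip /low_end; case: (boolP (bit b j)) => bb.
    by have := bit_low_end b j; rewrite /low_end bb => /negbTE->.
  by rewrite bit_add_self // addnK.
split => //; last by rewrite /= !inE !mem ij li lj i_s.
rewrite -[_ :: _ :: r]/([:: i; i + 2 ^ b] ++ r) -cat1s.
apply: computes_union c => //; last exact: computes_comparator.
- move=> b'; rewrite inE => /eqP-> j; rewrite !inE => /orP[]/eqP->.
    by rewrite flipi eqxx orbT.
  by rewrite flipj eqxx.
- by move=> b'; rewrite inE => /eqP-> j; rewrite !mem lflip.
by move=> j; rewrite !inE mem => /orP[]/eqP->; rewrite ?li ?lj.
Qed.

Lemma bit_addl b k base i : b < k -> 2 ^ k %| base -> bit b (base + i) = bit b i.
Proof.
move=> bk /dvdnP[q ->]; rewrite /bit -(subnK (ltnW bk)) expnD mulnA.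
by rewrite divnMDl ?expn2_gt0 // oddD oddM oddX subn_eq0 leqNgt bk andbF.
Qed.

(** Translates the index condition of [merge_layer] into a bit test. *)
Lemma modn_bit b i : (i %% 2 ^ b.+1 < 2 ^ b) = ~~ bit b i.
Proof.
rewrite /bit {2}(divn_eq i (2 ^ b.+1)) expnS mulnA divnMDl ?expn2_gt0 //.
rewrite oddD oddM andbF /=; set r := i %% _.
have : r < 2 * 2 ^ b by rewrite ltn_mod muln_gt0 expn2_gt0.
case: (ltnP r (2 ^ b)) => h; first by rewrite divn_small.
move=> h2; suff -> : r %/ 2 ^ b = 1 by [].
by apply/eqP; rewrite eqn_leq -ltnS ltn_divLR ?h2 ?expn2_gt0 // divn_gt0 ?h // expn2_gt0.
Qed.

Lemma merge_layer_computes up base k j : 0 < j -> j <= k -> 2 ^ k %| base ->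
  computes (merge_layer up base (2 ^ k) j) (iota base (2 ^ k)) up [:: k - j].
Proof.
move=> j0 jk kb; set b := k - j; have bk : b < k by rewrite /b; lia.
have e1 : 2 ^ k %/ 2 ^ j = 2 ^ b by rewrite -expnB.
have e2 : 2 ^ k %/ 2 ^ j.-1 = 2 ^ b.+1.
  by rewrite -expnB ?(leq_trans (leq_pred _)) //; congr (2 ^ _); rewrite /b; lia.
set s0 := [seq i <- iota 0 (2 ^ k) | ~~ bit b i].
pose s := [seq base + i | i <- s0].
have -> : merge_layer up base (2 ^ k) j = [seq oriented up i (i + 2 ^ b) | i <- s].
  rewrite /merge_layer e1 e2 -map_comp.
  rewrite (eq_filter (a2 := fun i => ~~ bit b i)) => [|i]; last exact: modn_bit.
  by apply: eq_map => i /=; rewrite addnA.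
have us : uniq s by rewrite map_inj_uniq ?filter_uniq ?iota_uniq //; apply: addnI.
have low : {in s, forall i, ~~ bit b i}.
  by move=> _ /mapP[i + ->]; rewrite mem_filter (bit_addl _ bk kb) => /andP[].
have [c u mem] := computes_layer up us low.
apply: computes_perm c; apply: uniq_perm => //; first exact: iota_uniq.
move=> x; rewrite mem mem_iota; apply/mapP/idP => [[i] | /andP[bx xk]].
  rewrite mem_filter mem_iota add0n => /andP[bi ik] lx.
  have : x = base + i \/ x = base + (i + 2 ^ b).
    move: lx; rewrite /low_end; case: ifPn => [/bit_ge h lx | _ ->]; last by left.
    by right; lia.
  by case=> ->; rewrite leq_addr ltn_add2l // ltn_add_bit.
exists (low_end b x - base); last first.
  rewrite subnKC // /low_end; case: ifP => //.
  by rewrite -{1}(subnKC bx) (bit_addl _ bk kb) => /bit_ge; lia.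
have e : low_end b x - base = low_end b (x - base).
  rewrite /low_end -{1}(subnKC bx) (bit_addl _ bk kb).
  by case: ifP => //; lia.
rewrite e mem_filter bit_low_end mem_iota add0n /=.
by rewrite /low_end; case: ifP; lia.
Qed.

Lemma closed_iota base k b : 2 ^ k %| base -> b < k -> closed_under (iota base (2 ^ k)) b.
Proof.
move=> kb bk i; rewrite -!(perm_mem (cube_iota k base)) => ib.
(* [clear] needs a power of two above [base], and 2 ^ (k + base) always is one. *)
apply: (@cube_flip (k + base)) ib; last by rewrite mem_iota.
apply: clear_iota => //; first exact: leq_addr.
by rewrite expnD; have := ltn_expl base (ltnSn 1); have := expn2_gt0 k; nia.
Qed.

Lemma bitonic_merge_computes up base k : 2 ^ k %| base ->
  computes (bitonic_merge up base k) (iota base (2 ^ k)) up (rev (iota 0 k)).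
Proof.
move=> kb; rewrite /bitonic_merge.
(* The first [j] layers act on the top [j] bits, from the highest one down. *)
suff gen j : j <= k ->
  computes (flatten [seq merge_layer up base (2 ^ k) j | j <- iota 1 j])
    (iota base (2 ^ k)) up (rev (iota (k - j) j)).
  by have := gen k (leqnn k); rewrite subnn.
elim: j => [_ w | j IH jk]; first by split=> // i /=; case: ifP.
rewrite -{1}[j.+1]addn1 iotaD map_cat flatten_cat add1n /= cats0.
rewrite rev_cons -cats1 (_ : (k - j.+1).+1 = k - j); last by lia.
apply: computes_seq; last 1 first.
- exact: merge_layer_computes.
- by move=> b; rewrite inE => /eqP->; apply: closed_iota => //; lia.
exact/IH/ltnW.
Qed.

Lemma bitonic_sortS up base k : bitonic_sort up base k.+1 =
  bitonic_sort up base k ++ bitonic_sort (~~ up) (base + 2 ^ k) k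
    ++ bitonic_merge up base k.+1.
Proof. by []. Qed.

Lemma bitonic_sort_outside up base k w i : 2 ^ k %| base ->
  i \notin iota base (2 ^ k) -> wires_after (bitonic_sort up base k) w i = w i.
Proof.
elim: k up base w => [|k IH] up base w kb; first by [].
have kb0 : 2 ^ k %| base by apply: dvdn_trans kb; rewrite dvdn_exp2l.
have kb1 : 2 ^ k %| base + 2 ^ k by rewrite dvdn_add.
rewrite bitonic_sortS 2!wires_after_cat => ib.
have [-> _] := bitonic_merge_computes up kb
  (wires_after (bitonic_sort (~~ up) (base + 2 ^ k) k)
     (wires_after (bitonic_sort up base k) w)).
rewrite (negbTE ib).
move: ib; rewrite expnS mul2n -addnn iotaD mem_cat negb_or => /andP[i1 i2].
by rewrite !IH.
Qed.

(** * Correctness of the network *)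

Fixpoint bool_val (x : nat -> bool) (g : wire) : bool :=
  match g with
  | Input i => x i
  | MinOut g1 g2 => bool_val x g1 && bool_val x g2
  | MaxOut g1 g2 => bool_val x g1 || bool_val x g2
  end.

(* A cyclic rotation of a sorted sequence. *)
Definition bitonic (v : nat -> bool) (m : nat) : Prop := exists a b c,
  [/\ a <= b, b <= m & forall i, i < m -> v i = (a <= i < b) (+) c].

Definition sorted01 (up : bool) (v : nat -> bool) (m : nat) : Prop :=
  exists2 a, a <= m & forall i, i < m -> v i = (a <= i) (+) ~~ up.

Definition bool_layer (up : bool) (b : nat) (v : nat -> bool) (i : nat) : bool :=
  if bit b i (+) up then v i && v (flip b i) else v (flip b i) || v i.

Definition bool_layers up bs v := foldl (fun v b => bool_layer up b v) v bs.

Lemma eq_bool_layer up b v v' : v =1 v' -> bool_layer up b v =1 bool_layer up b v'.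
Proof. by move=> e i; rewrite /bool_layer !e. Qed.

Lemma eq_bool_layers up bs v v' : v =1 v' -> bool_layers up bs v =1 bool_layers up bs v'.
Proof. by elim: bs v v' => //= b bs IH v v' e; apply/IH/eq_bool_layer. Qed.

Lemma bool_val_layers x up bs w i :
  bool_val x (layers up bs w i) = bool_layers up bs (fun j => bool_val x (w j)) i.
Proof.
elim: bs w => //= b bs IH w; rewrite IH; apply: eq_bool_layers => j.
by rewrite /layer /bool_layer; case: ifP.
Qed.

Lemma bool_layers_const up bs v r c : {in bs, forall b, closed_under r b} ->
  {in r, forall i, v i = c} -> {in r, forall i, bool_layers up bs v i = c}.
Proof.
elim: bs v => [|b bs IH] v cl e //=; apply: IH.
  by move=> b' b's; apply: cl; rewrite inE b's orbT.
move=> i ir; rewrite /bool_layer !e //; last exact: (cl b (mem_head _ _) i ir).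
by rewrite andbb orbb if_same.
Qed.

(** This is Batcher's half-cleaner property, proved by locating the block [a, b) of the values that
    differ from [c]. *)
Lemma half_cleaner u r : bitonic u (r + r) ->
  [/\ bitonic (fun i => u i && u (r + i)) r,
      bitonic (fun i => u i || u (r + i)) r &
      (forall i, i < r -> u i && u (r + i) = false) \/
      (forall i, i < r -> u i || u (r + i) = true)].
Proof.
case=> a [b] [c] [ab br e].
have e1 i : i < r -> u i = (a <= i < b) (+) c by move=> ir; apply: e; lia.
have e2 i : i < r -> u (r + i) = (a <= r + i < b) (+) c by move=> ir; apply: e; lia.
(* The block lies in the first half, in the second half, or across the middle; in the last case its
   two parts are disjoint or overlap modulo [r]. *)
have [b_r | r_b] := leqP b r; last have [r_a | a_r] := leqP r a;
  last have [b_a | a_b] := leqP (b - r) a.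
- split.
  + exists (if c then a else 0), (if c then b else 0), c.
    by split=> [||i ir]; rewrite ?e2 ?e1 //; move: (c) => [] /=;
      rewrite ?(addbT, addbF); lia.
  + exists (if c then 0 else a), (if c then 0 else b), c.
    by split=> [||i ir]; rewrite ?e2 ?e1 //; move: (c) => [] /=;
      rewrite ?(addbT, addbF); lia.
  by case: c e e1 e2 => e e1 e2; [right | left] => i ir;
    rewrite e2 // e1 // ?(addbT, addbF); lia.
- split.
  + exists (if c then a - r else 0), (if c then b - r else 0), c.
    by split=> [||i ir]; rewrite ?e2 ?e1 //; move: (c) => [] /=;
      rewrite ?(addbT, addbF); lia.
  + exists (if c then 0 else a - r), (if c then 0 else b - r), c.
    by split=> [||i ir]; rewrite ?e2 ?e1 //; move: (c) => [] /=;
      rewrite ?(addbT, addbF); lia.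
  by case: c e e1 e2 => e e1 e2; [right | left] => i ir;
    rewrite e2 // e1 // ?(addbT, addbF); lia.
- split.
  + exists (if c then b - r else 0), (if c then a else 0), false.
    by split=> [||i ir]; rewrite ?e2 ?e1 //; move: (c) => [] /=;
      rewrite ?(addbT, addbF); lia.
  + exists (if c then 0 else b - r), (if c then 0 else a), true.
    by split=> [||i ir]; rewrite ?e2 ?e1 //; move: (c) => [] /=;
      rewrite ?(addbT, addbF); lia.
  by case: c e e1 e2 => e e1 e2; [right | left] => i ir;
    rewrite e2 // e1 // ?(addbT, addbF); lia.
split.
+ exists (if c then 0 else a), (if c then 0 else b - r), false.
  by split=> [||i ir]; rewrite ?e2 ?e1 //; move: (c) => [] /=;
    rewrite ?(addbT, addbF); lia.
+ exists (if c then a else 0), (if c then b - r else 0), true.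
  by split=> [||i ir]; rewrite ?e2 ?e1 //; move: (c) => [] /=;
    rewrite ?(addbT, addbF); lia.
by case: c e e1 e2 => e e1 e2; [left | right] => i ir;
    rewrite e2 // e1 // ?(addbT, addbF); lia.
Qed.

Lemma bitonic_ext v v' m : (forall i, i < m -> v i = v' i) -> bitonic v m -> bitonic v' m.
Proof.
move=> e [a [b [c [ab bm h]]]]; exists a, b, c; split=> // i im.
by rewrite -e // h.
Qed.

(** After the top layer both halves are bitonic and get sorted by induction. One of them is constant
    and stays so, hence a single threshold describes the whole. *)
Lemma bitonic_merge_sorts up base k v : 2 ^ k %| base ->
  bitonic (fun i => v (base + i)) (2 ^ k) ->
  sorted01 up (fun i => bool_layers up (rev (iota 0 k)) v (base + i)) (2 ^ k).
Proof.
elim: k base v => [|k IH] base v kb.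
  move=> _; exists (v (base + 0) == ~~ up); first by case: eqP.
  move=> i; rewrite expn0 ltnS leqn0 => /eqP->.
  by rewrite /bool_layers /=; case: up; case: (v _).
have kb0 : 2 ^ k %| base by apply: dvdn_trans kb; rewrite dvdn_exp2l.
have kb1 : 2 ^ k %| base + 2 ^ k by rewrite dvdn_add.
rewrite expnS mul2n -addnn; set r := 2 ^ k => /half_cleaner[bl bh const].
have -> : rev (iota 0 k.+1) = k :: rev (iota 0 k) by rewrite -addn1 iotaD rev_cat.
rewrite /bool_layers /= -/(bool_layers _ _ _); set v' := bool_layer up k v.
have bit_lo i : i < r -> bit k (base + i) = false.
  by move=> ir; rewrite (bit_addl _ (ltnSn k) kb) /bit divn_small.
have lo i : i < r ->
    v' (base + i) = if up then v (base + i) && v (base + (r + i))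
                    else v (base + i) || v (base + (r + i)).
  move=> ir; rewrite /v' /bool_layer /flip bit_lo // -addnA (addnC i) /=.
  by case: (up) => //; rewrite orbC.
have hi i : i < r ->
    v' (base + r + i) = if up then v (base + i) || v (base + (r + i))
                        else v (base + i) && v (base + (r + i)).
  move=> ir; have bi : bit k (base + r + i).
    by rewrite addnAC bit_add_self // bit_lo.
  rewrite /v' /bool_layer /flip bi (addnAC base) addnK -!addnA (addnC i).
  by case: (up) => //; rewrite andbC.
clearbody v'.
have bit_lt b : b \in rev (iota 0 k) -> b < k by rewrite mem_rev mem_iota.
have const_lo c : (forall i, i < r -> v' (base + i) = c) ->
    forall i, i < r -> bool_layers up (rev (iota 0 k)) v' (base + i) = c.
  move=> h i ir; apply: (@bool_layers_const _ _ _ (iota base r)) =>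
    [b /bit_lt bk | j |].
  - exact: closed_iota.
  - by rewrite mem_iota => /andP[bj jr]; rewrite -(subnKC bj) h //; lia.
  by rewrite mem_iota; lia.
have const_hi c : (forall i, i < r -> v' (base + r + i) = c) ->
    forall i, i < r -> bool_layers up (rev (iota 0 k)) v' (base + r + i) = c.
  move=> h i ir; apply: (@bool_layers_const _ _ _ (iota (base + r) r)) =>
    [b /bit_lt bk | j |].
  - exact: closed_iota.
  - by rewrite mem_iota => /andP[bj jr]; rewrite -(subnKC bj) h //; lia.
  by rewrite mem_iota; lia.
have [|a1 a1r s1] := IH _ v' kb0.
  by move: lo; case: (up) => lo;
    [apply: bitonic_ext bl | apply: bitonic_ext bh] => i ir; rewrite lo.
have [|a2 a2r s2] := IH _ v' kb1.
  by move: hi; case: (up) => hi;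
    [apply: bitonic_ext bh | apply: bitonic_ext bl] => i ir; rewrite hi.
(* A threshold is right for the whole as soon as it agrees with the thresholds of both halves. *)
have glue a : a <= r + r ->
    (forall i, i < r -> (a1 <= i) (+) ~~ up = (a <= i) (+) ~~ up) ->
    (forall i, i < r -> (a2 <= i) (+) ~~ up = (a <= r + i) (+) ~~ up) ->
    sorted01 up (fun i => bool_layers up (rev (iota 0 k)) v' (base + i)) (r + r).
  move=> ar h1 h2; exists a => // i ir2; have [ir | ri] := ltnP i r.
    by rewrite s1 // h1.
  rewrite -(subnKC ri) addnA; have ir : i - r < r by lia.
  by rewrite s2 // h2.
have up_lo c : (forall i, i < r -> v' (base + i) = c) ->
    forall i, i < r -> (a1 <= i) (+) ~~ up = c.
  by move=> h i ir; rewrite -s1 // (const_lo c).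
have up_hi c : (forall i, i < r -> v' (base + r + i) = c) ->
    forall i, i < r -> (a2 <= i) (+) ~~ up = c.
  by move=> h i ir; rewrite -s2 // (const_hi c).
(* The constant half is the lower one if the constant is 0 going up or 1 going down, and the upper
   one otherwise; the threshold comes from the other half. *)
case: const => const;
  case: up lo hi glue up_lo up_hi {IH const_lo const_hi s1 s2} => lo hi glue up_lo up_hi.
- have {}up_lo := up_lo false (fun i ir => etrans (lo i ir) (const i ir)).
  by apply: (glue (r + a2)) => [|i ir|i ir]; rewrite ?up_lo //; lia.
- have {}up_hi := up_hi false (fun i ir => etrans (hi i ir) (const i ir)).
  by apply: (glue a1) => [|i ir|i ir]; rewrite ?up_hi //; lia.
- have {}up_hi := up_hi true (fun i ir => etrans (hi i ir) (const i ir)).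
  by apply: (glue a1) => [|i ir|i ir]; rewrite ?up_hi //; lia.
have {}up_lo := up_lo true (fun i ir => etrans (lo i ir) (const i ir)).
by apply: (glue (r + a2)) => [|i ir|i ir]; rewrite ?up_lo //; lia.
Qed.

Lemma bitonic_sort_sorts01 up base k w x : 2 ^ k %| base ->
  sorted01 up
    (fun i => bool_val x (wires_after (bitonic_sort up base k) w (base + i))) (2 ^ k).
Proof.
elim: k up base w => [|k IH] up base w kb.
  exists (bool_val x (w (base + 0)) == ~~ up); first by case: eqP.
  move=> i; rewrite expn0 ltnS leqn0 => /eqP->.
  by rewrite /=; case: up; case: (bool_val _ _).
have kb0 : 2 ^ k %| base by apply: dvdn_trans kb; rewrite dvdn_exp2l.
have kb1 : 2 ^ k %| base + 2 ^ k by rewrite dvdn_add.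
rewrite bitonic_sortS 2!wires_after_cat; set w1 := wires_after _ w.
set w2 := wires_after _ w1.
have [e _] := bitonic_merge_computes up kb w2.
have [|a ar s] := @bitonic_merge_sorts up base k.+1 (fun i => bool_val x (w2 i)) kb.
  have [a1 a1r s1] := IH up base w kb0; have [a2 a2r s2] := IH (~~ up) _ w1 kb1.
  rewrite expnS mul2n -addnn.
  (* The halves are sorted in opposite directions, so the values equal to [up] fill the block
     between the two switches. *)
  exists a1, (2 ^ k + a2), (~~ up); split; [lia | lia | move=> i ir2].
  have [ir | ri] := ltnP i (2 ^ k).
    rewrite /w2 bitonic_sort_outside //; last by rewrite mem_iota; lia.
    by rewrite s1 //; lia.
  have ir : i - 2 ^ k < 2 ^ k by lia.
  rewrite -(subnKC ri) addnA s2 //.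
  by case: up {IH w1 w2 e s1 s2}; lia.
exists a => // i ir; rewrite e mem_iota leq_addr ltn_add2l ir /=.
by rewrite bool_val_layers s.
Qed.

(** * The zero-one principle *)

Section ZeroOnePrinciple.
Variables (disp : Order.disp_t) (T : orderType disp) (x : nat -> T).

Fixpoint wire_val (g : wire) : T :=
  match g with
  | Input i => x i
  | MinOut g1 g2 => Order.min (wire_val g1) (wire_val g2)
  | MaxOut g1 g2 => Order.max (wire_val g1) (wire_val g2)
  end.

(** Thresholding is monotone and thus commutes with minimum and maximum. *)
Lemma bool_val_threshold t g : bool_val (fun i => t < x i)%O g = (t < wire_val g)%O.
Proof.
elim: g => //= g1 -> g2 ->; first by rewrite lt_min.
by rewrite lt_max.
Qed.

(** If two outputs were out of order, the input thresholded at the smaller of them would be a 0-1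
    input that the network fails to sort. *)
Lemma bitonic_wires_sorted k i j : i <= j -> j < 2 ^ k ->
  (wire_val (bitonic_wires k i) <= wire_val (bitonic_wires k j))%O.
Proof.
move=> ij jk; rewrite leNgt; apply/negP; set t := wire_val _ => h.
have [|a _ s] := @bitonic_sort_sorts01 true 0 k Input (fun i => t < x i)%O.
  exact: dvdn0.
have := s i (leq_ltn_trans ij jk); have := s j jk.
by rewrite !add0n !bool_val_threshold ltxx h; lia.
Qed.

End ZeroOnePrinciple.

(** * The program *)

(* Registers: 0 holds n, 1 holds k, 2 holds base, 3 holds 0 (1) for the
   direction up (down), and 4 to 8 hold lo, h, w, s and l. *)

Definition add_bit (e : expr) : com :=
  Assign 2 (Bin Add (Reg 2) (Bin Shl (Const 1) e)).

Definition decr (r : nat) : com := Assign r (Bin Defs.Sub (Reg r) (Const 1)).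

(* Tries k = 0, 1, ...; the calls nest, since a return restores the registers. *)
Definition main_code : com :=
  If (Bin Leq (Reg 0) (Bin Shl (Const 1) (Reg 1))) (Call 1)
     (Seq (Assign 1 (Bin Add (Reg 1) (Const 1))) (Call 0)).

Definition sort_code : com :=
  If (Reg 1)
    (Seq (decr 1)
    (Seq (Fork (Call 1)
               (Seq (add_bit (Reg 1))
               (Seq (Assign 3 (Bin Defs.Sub (Const 1) (Reg 3))) (Call 1))))
    (Seq (Assign 1 (Bin Add (Reg 1) (Const 1)))
    (Seq (Assign 8 (Const 0)) (Call 2)))))
    Skip.

(* Merges each of the 2 ^ l blocks of 2 ^ k positions that start at base: the
   layers at the upper half of the bits, then the merge of smaller blocks. *)
Definition merge_code : com :=
  If (Reg 8)
    (Seq (decr 8)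
         (Fork (Call 2) (Seq (add_bit (Bin Add (Reg 1) (Reg 8))) (Call 2))))
    (If (Reg 1)
      (Seq (Assign 6 (Bin Div (Reg 1) (Const 2)))
      (Seq (Assign 4 (Reg 6))
      (Seq (Assign 5 (Bin Defs.Sub (Reg 1) (Reg 6)))
      (Seq (Assign 7 (Const 0))
      (Seq (Call 3)
      (Seq (Assign 1 (Reg 6))
      (Seq (Assign 8 (Reg 5)) (Call 2))))))))
      Skip).

(** Shifting the direction by [lo] selects the end that receives the minimum without a branch. *)
Definition min_address : expr := Bin Add (Reg 2) (Bin Shl (Reg 3) (Reg 4)).

Definition max_address : expr :=
  Bin Add (Reg 2) (Bin Shl (Bin Defs.Sub (Const 1) (Reg 3)) (Reg 4)).

Definition compare_code : com :=
  Seq (Fetch 9 min_address)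
  (Seq (Fetch 10 max_address)
  (Seq (Comp 9 10 11)
  (Seq (Store min_address 9) (Store max_address 10)))).

(* The layers at the bits lo + h - 1, ..., lo, on the positions that differ
   from base at the bits in [s, s + l), [0, w) and [lo, lo + h) only. Blocks of
   2 ^ w adjacent positions are kept together until h is small. *)
Definition layers_code : com :=
  If (Reg 8)
    (Seq (decr 8)
         (Fork (Call 3) (Seq (add_bit (Bin Add (Reg 7) (Reg 8))) (Call 3))))
    (If (Bin Leq (Reg 6) (Bin Mul (Const 3) (Bin Defs.Sub (Reg 5) (Const 1))))
      (If (Bin Leq (Reg 5) (Const 1))
        compare_code
        (Seq (Assign 8 (Bin Div (Reg 5) (Const 2)))
        (Seq (Assign 7 (Reg 4))
        (Seq (Assign 5 (Bin Defs.Sub (Reg 5) (Reg 8)))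
        (Seq (Assign 4 (Bin Add (Reg 4) (Reg 8)))
        (Seq (Call 3)
        (Seq (Assign 1 (Reg 5))
        (Seq (Assign 5 (Reg 8))
        (Seq (Assign 8 (Reg 1))
        (Seq (Assign 4 (Reg 7))
        (Seq (Assign 7 (Bin Add (Reg 4) (Reg 5))) (Call 3))))))))))))
      (Seq (decr 6)
           (Fork (Call 3) (Seq (add_bit (Reg 6)) (Call 3))))).

Definition bitonic_program : program :=
  [:: main_code; sort_code; merge_code; layers_code].

Notation prog := bitonic_program.

Lemma frame_size_prog : frame_size prog = 13.
Proof. by rewrite /frame_size !big_cons big_nil. Qed.

(** * Plans *)

(* What remains of a computation without its operations on registers. *)
Inductive plan :=
  | PSkip
  | PComp of nat & nat
  | PCall of plan
  | PFork of plan & plan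
  | PSeq of plan & plan.

Fixpoint plan_net (p : plan) : seq comparator :=
  match p with
  | PSkip => [::]
  | PComp i j => [:: (i, j)]
  | PCall p => plan_net p
  | PFork p1 p2 | PSeq p1 p2 => plan_net p1 ++ plan_net p2
  end.

Fixpoint plan_trace (d : nat) (p : plan) : seq loc :=
  match p with
  | PSkip => [::]
  | PComp i j => [:: Heap i; Heap j; Heap i; Heap j]
  | PCall p => frame prog d ++ plan_trace d.+1 p ++ frame prog d
  | PFork p1 p2 => frame prog d ++ plan_trace d.+1 p1 ++ frame prog d
                     ++ plan_trace d.+1 p2 ++ frame prog d
  | PSeq p1 p2 => plan_trace d p1 ++ plan_trace d p2
  end.

Lemma trace_call d p : plan_trace d (PCall p) =
  frame prog d ++ plan_trace d.+1 p ++ frame prog d.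
Proof. by []. Qed.

Lemma trace_fork d p1 p2 : plan_trace d (PFork p1 p2) =
  frame prog d ++ plan_trace d.+1 p1 ++ frame prog d
    ++ plan_trace d.+1 p2 ++ frame prog d.
Proof. by []. Qed.

Lemma trace_seq d p1 p2 :
  plan_trace d (PSeq p1 p2) = plan_trace d p1 ++ plan_trace d p2.
Proof. by []. Qed.

Fixpoint plan_work (p : plan) : nat :=
  match p with
  | PCall p => (plan_work p).+1
  | PFork p1 p2 | PSeq p1 p2 => (plan_work p1 + plan_work p2).+1
  | _ => 1
  end.

Fixpoint plan_span (p : plan) : nat :=
  match p with
  | PCall p => (plan_span p).+1
  | PFork p1 p2 => (maxn (plan_span p1) (plan_span p2)).+1
  | PSeq p1 p2 => (plan_span p1 + plan_span p2).+1
  | _ => 1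
  end.

Fixpoint plan_depth (p : plan) : nat :=
  match p with
  | PCall p => (plan_depth p).+1
  | PFork p1 p2 => (maxn (plan_depth p1) (plan_depth p2)).+1
  | PSeq p1 p2 => maxn (plan_depth p1) (plan_depth p2)
  | _ => 0
  end.

Definition addresses (p : plan) : seq nat :=
  flatten [seq [:: pq.1; pq.2] | pq <- plan_net p].

(* 200 exceeds the number of operations of a procedure body together with the
   saving and restoring of its frames. *)
Record follows (d : nat) (p : plan) (D : dag) : Prop := Follows {
  follows_work : dag_work D <= 200 * plan_work p;
  follows_span : dag_span D <= 200 * plan_span p;
  follows_race_free : race_free D;
  follows_accesses : accesses D = plan_trace d p }.

(** * Frames, memory traces and races *)

Lemma accesses_save d : accesses (save_frame prog d) = frame prog d.
Proof. by rewrite /save_frame; elim: (frame _ _) => //= l s ->. Qed.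

Lemma accesses_restore d : accesses (restore_frame prog d) = frame prog d.
Proof. by rewrite /restore_frame; elim: (frame _ _) => //= l s ->. Qed.

Lemma size_frame d : size (frame prog d) = 13.
Proof. by rewrite size_map size_iota frame_size_prog. Qed.

Lemma work_save d : dag_work (save_frame prog d) = 14.
Proof.
rewrite -(size_frame d) /save_frame; elim: (frame _ _) => //= l s ->.
by rewrite add1n.
Qed.

Lemma work_restore d : dag_work (restore_frame prog d) = 14.
Proof.
rewrite -(size_frame d) /restore_frame; elim: (frame _ _) => //= l s ->.
by rewrite add1n.
Qed.

Lemma span_save d : dag_span (save_frame prog d) = 14.
Proof.
rewrite -(size_frame d) /save_frame; elim: (frame _ _) => //= l s ->.
by rewrite add1n.
Qed.

Lemma span_restore d : dag_span (restore_frame prog d) = 14.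
Proof.
rewrite -(size_frame d) /restore_frame; elim: (frame _ _) => //= l s ->.
by rewrite add1n.
Qed.

Lemma race_free_save d : race_free (save_frame prog d).
Proof. by rewrite /save_frame; elim: (frame _ _). Qed.

Lemma race_free_restore d : race_free (restore_frame prog d).
Proof. by rewrite /restore_frame; elim: (frame _ _). Qed.

Lemma heap_frame i d : (Heap i \in frame prog d) = false.
Proof. by apply/negP => /mapP[]. Qed.

Lemma stack_frame i d : Stack i \in frame prog d -> 13 * d <= i < 13 * d.+1.
Proof.
case/mapP=> j; rewrite mem_iota frame_size_prog => jd [->]; lia.
Qed.

#[local] Opaque save_frame restore_frame frame.

Definition dagE := (work_save, work_restore, span_save, span_restore,
  race_free_save, race_free_restore, accesses_save, accesses_restore).

Lemma writes_accesses D : {subset writes D <= accesses D}.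
Proof.
by elim: D => [|?|?|D1 IH1 D2 IH2|D1 IH1 D2 IH2] //= l;
  rewrite !mem_cat => /orP[/IH1->//|/IH2->]; rewrite orbT.
Qed.

Lemma heap_trace i d p : Heap i \in plan_trace d p -> i \in addresses p.
Proof.
elim: p d => [|a b|p IH|p1 IH1 p2 IH2|p1 IH1 p2 IH2] d //.
- by rewrite /addresses /= !inE => /or4P[]/eqP[->]; rewrite eqxx ?orbT.
- by rewrite trace_call !mem_cat !heap_frame orbF => /IH.
- rewrite trace_fork !mem_cat !heap_frame /addresses map_cat flatten_cat mem_cat.
  by rewrite orbF /= => /orP[/IH1->//|/IH2->]; rewrite orbT.
rewrite trace_seq /addresses map_cat flatten_cat !mem_cat.
by case/orP => [/IH1->//|/IH2->]; rewrite orbT.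
Qed.

Lemma addresses_cat p1 p2 i :
  (i \in addresses (PSeq p1 p2)) = (i \in addresses p1) || (i \in addresses p2).
Proof. by rewrite /addresses map_cat flatten_cat mem_cat. Qed.

(** All heap accesses of a task are at the [addresses] of its plan, and restoring a frame touches
    only the stack, so disjoint addresses rule out conflicts. *)
Lemma par_race_free d d1 d2 p1 p2 D1 D2 :
  follows d1 p1 D1 -> follows d2 p2 D2 ->
  {in addresses p1, forall i, i \notin addresses p2} ->
  race_free (Par D1 (Ser (restore_frame prog d) D2)).
Proof.
case=> _ _ r1 a1 [_ _ r2 a2] dis; rewrite /= r1 r2 race_free_restore /=.
apply/andP; split; apply/allP => l.
  move=> /writes_accesses; rewrite a1; case: l => //= i /heap_trace /dis.
  apply: contra; rewrite accesses_restore mem_cat heap_frame a2.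
  exact: heap_trace.
rewrite /= mem_cat => h; case: l h => //= i.
case/orP => /writes_accesses; first by rewrite accesses_restore heap_frame.
rewrite a1 a2 => /heap_trace h2; apply/negP => /heap_trace /dis.
by rewrite h2.
Qed.

(** Confines the stack accesses to one interval, so that they meet few blocks. *)
Lemma stack_trace i d p : Stack i \in plan_trace d p ->
  13 * d <= i < 13 * (d + plan_depth p).
Proof.
elim: p d => [|a b|p IH|p1 IH1 p2 IH2|p1 IH1 p2 IH2] d //.
- by rewrite trace_call !mem_cat /= => /or3P[/stack_frame|/IH|/stack_frame]; lia.
- rewrite trace_fork !mem_cat /=.
  by case/or4P => [/stack_frame|/IH1|/stack_frame|/orP[/IH2|/stack_frame]]; lia.
by rewrite trace_seq mem_cat /= => /orP[/IH1|/IH2]; lia.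
Qed.

(** * Execution of plans *)

Section HeapNetworks.
Variables (disp : Order.disp_t) (T : orderType disp).
Implicit Types (u v : value T) (mu : nat -> value T).

(** A comparator that meets a word leaves both values in place, which makes its effect on heaps
    total. *)
Definition value_min u v : value T :=
  if (u, v) is (Elem x g, Elem y h) then Elem (Order.min x y) (MinOut g h) else u.

Definition value_max u v : value T :=
  if (u, v) is (Elem x g, Elem y h) then Elem (Order.max x y) (MaxOut g h) else v.

Definition value_wire v : wire := if v is Elem _ g then g else Input 0.

Definition heap_step mu (pq : comparator) : nat -> value T :=
  upd (upd mu pq.1 (value_min (mu pq.1) (mu pq.2))) pq.2
      (value_max (mu pq.1) (mu pq.2)).

Definition heap_after (net : seq comparator) mu : nat -> value T :=
  foldl heap_step mu net.

Fixpoint heap_gates (net : seq comparator) mu : seq gate :=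
  if net is pq :: net' then
    (value_wire (mu pq.1), value_wire (mu pq.2)) :: heap_gates net' (heap_step mu pq)
  else [::].

Definition all_elems (n : nat) mu : Prop :=
  forall i, i < n -> exists x g, mu i = Elem x g.

Lemma heap_after_cat net1 net2 mu :
  heap_after (net1 ++ net2) mu = heap_after net2 (heap_after net1 mu).
Proof. exact: foldl_cat. Qed.

Lemma heap_gates_cat net1 net2 mu : heap_gates (net1 ++ net2) mu =
  heap_gates net1 mu ++ heap_gates net2 (heap_after net1 mu).
Proof. by elim: net1 mu => //= pq net1 IH mu; rewrite IH. Qed.

Lemma all_elems_after n net mu : all_elems n mu -> all_elems n (heap_after net mu).
Proof.
elim: net mu => //= -[p q] net IH mu el; apply: IH => i ik; rewrite /heap_step /upd.
have [x [g e]] := el i ik.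
rewrite /value_min /value_max /=.
case: eqP => [<-|_]; first by rewrite e; case: (mu p) => *; do 2!eexists.
case: eqP => [<-|_]; last by exists x, g.
by rewrite e; case: (mu q) => *; do 2!eexists.
Qed.

End HeapNetworks.

(* The DAG D is chosen before the order type and the input: this is what makes
   the program data-oblivious. *)
Definition implements (n d pr : nat) (regs : seq (nat * nat)) (p : plan) : Prop :=
  exists2 D, follows d p D &
    forall (disp : Order.disp_t) (T : orderType disp) (W : nat)
      (rho mu : nat -> value T),
    8 * n + 8 <= W -> all_elems n mu ->
    {in regs, forall rv, rho rv.1 = Word rv.2} ->
    exec W prog d (Call pr) rho mu rho (heap_after (plan_net p) mu) D
      (heap_gates (plan_net p) mu).

Section Evaluation.
Variables (T : Type) (W : nat) (rho : nat -> value T).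

Lemma eval_const v : v < W -> eval W rho (Const v) = Some v.
Proof. by rewrite /= /bounded => ->. Qed.

Lemma eval_reg r v : rho r = Word v -> v < W -> eval W rho (Reg r) = Some v.
Proof. by rewrite /= /bounded => -> ->. Qed.

Lemma eval_bin o e1 e2 v1 v2 v :
  eval W rho e1 = Some v1 -> eval W rho e2 = Some v2 ->
  binop_sem o v1 v2 = v -> v < W -> eval W rho (Bin o e1 e2) = Some v.
Proof. by rewrite /= /bounded => -> -> -> ->. Qed.

End Evaluation.

(** Leaves the final heap and the gates to be matched by equations, since an execution built step by
    step yields them in another form. *)
Lemma exec_call_eq disp (T : orderType disp) W d pr
    (rho mu rho' mu' mu'' : nat -> value T) D gs gs' :
  exec W prog d.+1 (nth Skip prog pr) rho mu rho' mu' D gs ->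
  mu' = mu'' -> gs = gs' ->
  exec W prog d (Call pr) rho mu rho mu''
    (Ser (save_frame prog d) (Ser D (restore_frame prog d))) gs'.
Proof. by move=> E <- <-; apply: exec_call E. Qed.

Ltac solve_reg := rewrite /upd /=; (eassumption || reflexivity).
Ltac solve_eval :=
  lazymatch goal with
  | |- eval _ _ (Const _) = _ => eapply eval_const; lia
  | |- eval _ _ (Reg _) = _ => eapply eval_reg; [solve_reg | rewrite /=; lia]
  | |- _ => eapply eval_bin; [solve_eval | solve_eval
                  | first [reflexivity | rewrite /=; lia] | rewrite /=; lia]
  end.
Ltac assign x := eapply exec_seq; [eapply exec_set with (v := x); solve_eval | ].
Ltac branch x := eapply exec_if with (v := x); [solve_eval | rewrite /=].
Ltac word := rewrite /upd /=; first [eassumption | reflexivity | by congr Word; lia].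

(** * The layers of a merge *)

Definition free_bits (lo h w s l : nat) : seq nat :=
  iota s l ++ iota 0 w ++ iota lo h.

Lemma iota_last m l : perm_eq (iota m l.+1) (m + l :: iota m l).
Proof. by rewrite -addn1 iotaD perm_catC. Qed.

Lemma free_bits_loop lo h w s l :
  perm_eq (free_bits lo h w s l.+1) (s + l :: free_bits lo h w s l).
Proof. by rewrite -cat_cons perm_cat2r iota_last. Qed.

Lemma free_bits_width lo h w s :
  perm_eq (free_bits lo h w.+1 s 0) (w :: free_bits lo h w s 0).
Proof. by have := iota_last 0 w; rewrite -(perm_cat2r (iota lo h)). Qed.

(** The bits whose layers a recursive call leaves out become its loop range, so it has the free bits
    of its parent. Here the call treats the upper bits, in [free_bits_low] the lower ones. *)
Lemma free_bits_high lo h1 h2 w s :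
  perm_eq (free_bits lo (h1 + h2) w s 0) (free_bits (lo + h1) h2 w lo h1).
Proof. by rewrite /free_bits iotaD /= perm_catCA. Qed.

Lemma free_bits_low lo h1 h2 w s :
  perm_eq (free_bits lo (h1 + h2) w s 0) (free_bits lo h1 w (lo + h1) h2).
Proof.
rewrite /free_bits iotaD /= perm_catCA perm_sym perm_catCA /=.
by rewrite perm_catC -!catA perm_catCA perm_cat2l perm_catC.
Qed.

(** A relation, because the recursion is not structural. Its constructors mirror the branches of
    [layers_code], and rule induction on it drives the proofs about layers. *)
Inductive layers_plan (up : bool) :
    nat -> nat -> nat -> nat -> nat -> nat -> plan -> Prop :=
  | LoopPlan base lo h w s l p1 p2 :
      layers_plan up base lo h w s l p1 ->
      layers_plan up (base + 2 ^ (s + l)) lo h w s l p2 ->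
      layers_plan up base lo h w s l.+1 (PCall (PFork p1 p2))
  | WidthPlan base lo h w s p1 p2 :
      3 * (h - 1) <= w ->
      layers_plan up base lo h w s 0 p1 ->
      layers_plan up (base + 2 ^ w) lo h w s 0 p2 ->
      layers_plan up base lo h w.+1 s 0 (PCall (PFork p1 p2))
  | CompPlan base lo s :
      layers_plan up base lo 1 0 s 0
        (PCall (PComp (oriented up base (base + 2 ^ lo)).1
                      (oriented up base (base + 2 ^ lo)).2))
  | LayerPlan base lo h w s p1 p2 :
      1 < h -> w <= 3 * (h - 1) ->
      layers_plan up base (lo + h %/ 2) (h - h %/ 2) w lo (h %/ 2) p1 ->
      layers_plan up base lo (h %/ 2) w (lo + h %/ 2) (h - h %/ 2) p2 ->
      layers_plan up base lo h w s 0 (PCall (PSeq p1 p2)).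

(** The induction is lexicographic: a layer split lowers [h] and resets [l]; for fixed [h] the loop
    runs down first, then the width. *)
Lemma layers_plan_exists up base lo h w s l :
  0 < h -> exists p, layers_plan up base lo h w s l p.
Proof.
elim/ltn_ind: h base lo w s l => h IHh base lo w s l h0.
elim: l base => [|l IHl] base; last first.
  have [p1 q1] := IHl base; have [p2 q2] := IHl (base + 2 ^ (s + l)).
  by eexists; apply: LoopPlan q1 q2.
elim: w base => [|w IHw] base; last have [hw | wh] := leqP (3 * (h - 1)) w.
- have [h1 | h1] := leqP h 1.
    have -> : h = 1 by lia.
    by eexists; apply: CompPlan.
  have [||p1 q1] := IHh (h - h %/ 2) _ base (lo + h %/ 2) 0 lo (h %/ 2); try lia.
  have [||p2 q2] := IHh (h %/ 2) _ base lo 0 (lo + h %/ 2) (h - h %/ 2); try lia.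
  by eexists; apply: LayerPlan q1 q2.
- have [p1 q1] := IHw base; have [p2 q2] := IHw (base + 2 ^ w).
  by eexists; apply: WidthPlan q1 q2.
have [||p1 q1] := IHh (h - h %/ 2) _ base (lo + h %/ 2) w.+1 lo (h %/ 2); try lia.
have [||p2 q2] := IHh (h %/ 2) _ base lo w.+1 (lo + h %/ 2) (h - h %/ 2); try lia.
by eexists; apply: LayerPlan q1 q2 => //; lia.
Qed.

Lemma layers_plan_h_gt0 up base lo h w s l p :
  layers_plan up base lo h w s l p -> 0 < h.
Proof. by elim=> // *; lia. Qed.

Section LayersPlan.
Variables (up : bool) (k : nat).

Lemma clear_loop base lo h w s l :
  clear k (free_bits lo h w s l.+1) base ->
  clear k (free_bits lo h w s l) base && clear k (free_bits lo h w s l) (base + 2 ^ (s + l)).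
Proof. by rewrite (clear_perm _ _ (free_bits_loop _ _ _ _ _)) => /clear_cons. Qed.

Lemma clear_width base lo h w s :
  clear k (free_bits lo h w.+1 s 0) base ->
  clear k (free_bits lo h w s 0) base && clear k (free_bits lo h w s 0) (base + 2 ^ w).
Proof. by rewrite (clear_perm _ _ (free_bits_width _ _ _ _)) => /clear_cons. Qed.

Lemma clear_layer base lo h w s :
  clear k (free_bits lo h w s 0) base ->
  clear k (free_bits (lo + h %/ 2) (h - h %/ 2) w lo (h %/ 2)) base &&
  clear k (free_bits lo (h %/ 2) w (lo + h %/ 2) (h - h %/ 2)) base.
Proof.
have e : h %/ 2 + (h - h %/ 2) = h by lia.
have q1 := free_bits_high lo (h %/ 2) (h - h %/ 2) w s.
have q2 := free_bits_low lo (h %/ 2) (h - h %/ 2) w s.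
rewrite e in q1; rewrite e in q2.
by rewrite -(clear_perm _ _ q1) -(clear_perm _ _ q2) => ->.
Qed.

Lemma layers_plan_addresses base lo h w s l p :
  layers_plan up base lo h w s l p ->
  {subset addresses p <= cube (free_bits lo h w s l) base}.
Proof.
elim=> {base lo h w s l p} [base lo h w s l p1 p2 _ IH1 _ IH2
    |base lo h w s p1 p2 _ _ IH1 _ IH2|base lo s
    |base lo h w s p1 p2 _ _ _ IH1 _ IH2] i.
- rewrite (perm_mem (cube_perm _ (free_bits_loop _ _ _ _ _))) /= mem_cat.
  by rewrite (addresses_cat p1 p2) => /orP[/IH1-> //|/IH2->]; rewrite orbT.
- rewrite (perm_mem (cube_perm _ (free_bits_width _ _ _ _))) /= mem_cat.
  by rewrite (addresses_cat p1 p2) => /orP[/IH1-> //|/IH2->]; rewrite orbT.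
- by rewrite /addresses /= !inE; case: (up) => //; rewrite orbC.
have e : h %/ 2 + (h - h %/ 2) = h by lia.
have q1 := cube_perm base (free_bits_high lo (h %/ 2) (h - h %/ 2) w s).
have q2 := cube_perm base (free_bits_low lo (h %/ 2) (h - h %/ 2) w s).
rewrite e in q1; rewrite e in q2; rewrite (addresses_cat p1 p2).
by case/orP => [/IH1|/IH2]; [rewrite (perm_mem q1) | rewrite (perm_mem q2)].
Qed.

(** Loop and width steps join two disjoint cubes. A layer split composes the upper layers with the
    lower ones on one and the same cube. *)
Lemma layers_plan_computes base lo h w s l p :
  layers_plan up base lo h w s l p -> clear k (free_bits lo h w s l) base ->
  computes (plan_net p) (cube (free_bits lo h w s l) base) up (rev (iota lo h)).
Proof.
have closed fs b lo' h' w' s' l' : clear k (free_bits lo' h' w' s' l') b ->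
    fs = rev (iota lo' h') ->
    {in fs, forall f, closed_under (cube (free_bits lo' h' w' s' l') b) f}.
  move=> clr -> f fr i; apply: cube_flip clr _.
  by move: fr; rewrite mem_rev /free_bits !mem_cat => ->; rewrite !orbT.
elim=> {base lo h w s l p} [base lo h w s l p1 p2 _ IH1 _ IH2
    |base lo h w s p1 p2 _ _ IH1 _ IH2|base lo s
    |base lo h w s p1 p2 _ _ _ IH1 _ IH2] clr.
- have /andP[c1 c2] := clear_loop clr.
  rewrite (clear_perm _ _ (free_bits_loop _ _ _ _ _)) in clr.
  have p := cube_perm base (free_bits_loop lo h w s l).
  rewrite perm_sym in p; apply: (computes_perm p).
  apply: computes_union (IH1 c1) (IH2 c2); try exact: closed.
  by move=> i; apply: cube_disjoint clr.
- have /andP[c1 c2] := clear_width clr.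
  rewrite (clear_perm _ _ (free_bits_width _ _ _ _)) in clr.
  have p := cube_perm base (free_bits_width lo h w s).
  rewrite perm_sym in p; apply: (computes_perm p).
  apply: computes_union (IH1 c1) (IH2 c2); try exact: closed.
  by move=> i; apply: cube_disjoint clr.
- have bb : ~~ bit lo base by case/and3P: clr => _ /= /andP[/andP[]].
  by have := computes_comparator up bb; rewrite /=; case: (oriented _ _ _).
have /andP[c1 c2] := clear_layer clr.
have e : h %/ 2 + (h - h %/ 2) = h by lia.
have q1 := cube_perm base (free_bits_high lo (h %/ 2) (h - h %/ 2) w s).
have q2 := cube_perm base (free_bits_low lo (h %/ 2) (h - h %/ 2) w s).
rewrite e perm_sym in q1; rewrite e perm_sym in q2.
rewrite -{2}e iotaD rev_cat; apply: computes_seq.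
- move=> f fr; have := closed _ _ _ _ _ _ _ c2 (erefl _) f fr.
  by move=> cl i; rewrite -!(perm_mem q2); apply: cl.
- exact: computes_perm q1 (IH1 c1).
exact: computes_perm q2 (IH2 c2).
Qed.

End LayersPlan.

Lemma clear_iota_le k m j fs base :
  clear k fs base -> {subset iota m j <= fs} -> 0 < j -> m + j <= k.
Proof.
case/and3P=> _ /allP a _ sub j0; have : m + j.-1 \in fs.
  by apply: sub; rewrite mem_iota; lia.
by case/a/andP; lia.
Qed.

Lemma clear_free_bits k base lo h w s l : clear k (free_bits lo h w s l) base ->
  0 < h -> [/\ lo + h <= k, w <= k, (0 < l -> s + l <= k) & base < 2 ^ k].
Proof.
move=> clr h0; split; last by case/and3P: clr.
- by apply: clear_iota_le clr _ h0 => i; rewrite !mem_cat => ->; rewrite !orbT.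
- case: w clr => // w clr.
  by apply: (clear_iota_le (m := 0) clr) => // i; rewrite !mem_cat => ->; rewrite !orbT.
by apply: clear_iota_le clr _ => i; rewrite !mem_cat => ->.
Qed.

Definition layers_regs (up : bool) (base lo h w s l : nat) : seq (nat * nat) :=
  [:: (2, base); (3, nat_of_bool (~~ up)); (4, lo); (5, h); (6, w); (7, s); (8, l)].

(** The forked bit is 0 in the addresses of the first task and 1 in those of the second. *)
Lemma fork_disjoint up k base lo h w s l f fs p1 p2 :
  perm_eq (free_bits lo h w s l) fs -> clear k (f :: fs) base ->
  layers_plan up base lo h w s l p1 ->
  layers_plan up (base + 2 ^ f) lo h w s l p2 ->
  {in addresses p1, forall i, i \notin addresses p2}.
Proof.
move=> p clr q1 q2 i /(layers_plan_addresses q1).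
rewrite (perm_mem (cube_perm _ p)) => /(cube_disjoint clr); apply: contra.
by move/(layers_plan_addresses q2); rewrite (perm_mem (cube_perm _ p)).
Qed.

Section Registers.
Variables (T : Type) (rho : nat -> value T) (up : bool) (base lo h w s l : nat).

Lemma layers_regs_inv :
  {in layers_regs up base lo h w s l, forall rv, rho rv.1 = Word rv.2} ->
  [/\ rho 2 = Word base, rho 3 = Word (~~ up), rho 4 = Word lo &
      [/\ rho 5 = Word h, rho 6 = Word w, rho 7 = Word s & rho 8 = Word l]].
Proof.
move=> r; split; [apply: (r (2, base)) | apply: (r (3, nat_of_bool (~~ up)))
  | apply: (r (4, lo)) | split; [apply: (r (5, h)) | apply: (r (6, w))
  | apply: (r (7, s)) | apply: (r (8, l))]]; by rewrite !inE eqxx ?orbT.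
Qed.

Lemma layers_regs_intro :
  rho 2 = Word base -> rho 3 = Word (~~ up) -> rho 4 = Word lo ->
  rho 5 = Word h -> rho 6 = Word w -> rho 7 = Word s -> rho 8 = Word l ->
  {in layers_regs up base lo h w s l, forall rv, rho rv.1 = Word rv.2}.
Proof.
by move=> r2 r3 r4 r5 r6 r7 r8 rv; rewrite !inE; do ![case/orP]; move/eqP->.
Qed.

End Registers.

Ltac solve_follows F1 F2 :=
  split; [ by rewrite /= !dagE; move: (follows_work F1) (follows_work F2); lia
         | by rewrite /= !dagE; move: (follows_span F1) (follows_span F2); lia
         | 
         | by rewrite /= !dagE (follows_accesses F1) (follows_accesses F2) ?cats0 -?catA ].

Lemma layers_plan_implements up k base lo h w s l p :
  layers_plan up base lo h w s l p -> clear k (free_bits lo h w s l) base ->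
  forall d, implements (2 ^ k) d 3 (layers_regs up base lo h w s l) p.
Proof.
have k_lt := ltn_expl k (ltnSn 1).
have pow_le f : f <= k -> 2 ^ f <= 2 ^ k by move=> fk; rewrite leq_exp2l.
elim=> {base lo h w s l p} [base lo h w s l p1 p2 q1 IH1 q2 IH2
    |base lo h w s p1 p2 hw q1 IH1 q2 IH2|base lo s
    |base lo h w s p1 p2 h1 wh q1 IH1 q2 IH2] clr d.
- have /andP[c1 c2] := clear_loop clr.
  have [lok wk /(_ (ltn0Sn l)) slk bk] := clear_free_bits clr (layers_plan_h_gt0 q1).
  have [_ _ _ bk2] := clear_free_bits c2 (layers_plan_h_gt0 q1).
  have pslk := pow_le (s + l) ltac:(lia).
  (* The call and the fork push one frame each, hence the depth [d.+2]. *)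
  have [D1 F1 E1] := IH1 c1 d.+2; have [D2 F2 E2] := IH2 c2 d.+2.
  rewrite (clear_perm _ _ (free_bits_loop _ _ _ _ _)) in clr.
  have dis := fork_disjoint (perm_refl _) clr q1 q2.
  (* The DAG is left open before the order type, the registers and the heap are introduced, so the
     execution that determines it cannot make it depend on them. Its costs are checked
     afterwards. *)
  eexists; last first.
    move=> disp T W rho mu HW el regs.
    have [r2 r3 r4 [r5 r6 r7 r8]] := layers_regs_inv regs.
    eapply exec_call_eq.
    + rewrite -[nth _ _ _]/layers_code /layers_code; branch l.+1; assign l.
      eapply exec_fork.
        by apply: E1 => //; apply: layers_regs_intro.
      assign (base + 2 ^ (s + l)).
      apply: E2 => //; first exact: all_elems_after.
      by apply: layers_regs_intro.
    + by rewrite heap_after_cat.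
    by rewrite heap_gates_cat.
  solve_follows F1 F2.
  by have := par_race_free d.+1 F1 F2 dis; rewrite /= !dagE !andbT => ->.
- have /andP[c1 c2] := clear_width clr.
  have [lok wk _ bk] := clear_free_bits clr (layers_plan_h_gt0 q1).
  have [_ _ _ bk2] := clear_free_bits c2 (layers_plan_h_gt0 q1).
  have pwk := pow_le w ltac:(lia).
  have [D1 F1 E1] := IH1 c1 d.+2; have [D2 F2 E2] := IH2 c2 d.+2.
  rewrite (clear_perm _ _ (free_bits_width _ _ _ _)) in clr.
  have dis := fork_disjoint (perm_refl _) clr q1 q2.
  eexists; last first.
    move=> disp T W rho mu HW el regs.
    have [r2 r3 r4 [r5 r6 r7 r8]] := layers_regs_inv regs.
    eapply exec_call_eq.
    + rewrite -[nth _ _ _]/layers_code /layers_code; branch 0; branch 0; assign w.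
      eapply exec_fork.
        by apply: E1 => //; apply: layers_regs_intro.
      assign (base + 2 ^ w).
      apply: E2 => //; first exact: all_elems_after.
      by apply: layers_regs_intro.
    + by rewrite heap_after_cat.
    by rewrite heap_gates_cat.
  solve_follows F1 F2.
  by have := par_race_free d.+1 F1 F2 dis; rewrite /= !dagE !andbT => ->.
- have [lok _ _ bk] := clear_free_bits clr isT.
  have plk := pow_le lo ltac:(lia).
  have bk2 : base + 2 ^ lo < 2 ^ k.
    by apply: ltn_add_bit => //; case/and3P: clr => _ /= /andP[/andP[]].
  set i := (oriented _ _ _).1; set j := (oriented _ _ _).2.
  have [ei ej] : i = base + (~~ up) * 2 ^ lo /\ j = base + (1 - ~~ up) * 2 ^ lo.
    by rewrite /i /j; case: (up); rewrite /= ?mul1n ?mul0n ?addn0.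
  have [ik jk] : i < 2 ^ k /\ j < 2 ^ k by rewrite ei ej; case: (up); lia.
  have dir1 : ~~ up <= 1 by case: (up).
  have dk1 : ~~ up * 2 ^ lo <= 2 ^ k by case: (up); lia.
  have dk2 : (1 - ~~ up) * 2 ^ lo <= 2 ^ k by case: (up); lia.
  clearbody i j.
  eexists; last first.
    move=> disp T W rho mu HW el regs.
    have [r2 r3 r4 [r5 r6 r7 r8]] := layers_regs_inv regs.
    move: (nat_of_bool (~~ up)) r3 dir1 ei ej dk1 dk2 => dir r3 dir1 ei ej dk1 dk2.
    have [x1 [g1 e1]] := el i ik; have [x2 [g2 e2]] := el j jk.
    eapply exec_call_eq.
    + rewrite -[nth _ _ _]/layers_code /layers_code; branch 0; branch 1; branch 1.
      eapply exec_seq; [eapply exec_load with (a := i); solve_eval | ].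
      eapply exec_seq; [eapply exec_load with (a := j); solve_eval | ].
      eapply exec_seq; [eapply exec_comp; solve_reg | ].
      eapply exec_seq; [eapply exec_store with (a := i); solve_eval | ].
      eapply exec_store with (a := j); solve_eval.
    + by rewrite /= /heap_step /= e1 e2.
    by rewrite /= e1 e2.
  by split; rewrite /= ?dagE.
have /andP[c1 c2] := clear_layer clr.
have [lok wk _ bk] := clear_free_bits clr (ltnW h1).
have [D1 F1 E1] := IH1 c1 d.+1; have [D2 F2 E2] := IH2 c2 d.+1.
eexists; last first.
  move=> disp T W rho mu HW el regs.
    have [r2 r3 r4 [r5 r6 r7 r8]] := layers_regs_inv regs.
  eapply exec_call_eq.
  + rewrite -[nth _ _ _]/layers_code /layers_code; branch 0; branch 1; branch 0.
    assign (h %/ 2); assign lo; assign (h - h %/ 2); assign (lo + h %/ 2).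
    eapply exec_seq; first by apply: E1 => //; apply: layers_regs_intro.
    assign (h - h %/ 2); assign (h %/ 2); assign (h - h %/ 2); assign lo.
    assign (lo + h %/ 2).
    apply: E2 => //; first exact: all_elems_after.
    by apply: layers_regs_intro.
  + by rewrite /= heap_after_cat.
  by rewrite /= heap_gates_cat.
solve_follows F1 F2.
by rewrite /= !dagE (follows_race_free F1) (follows_race_free F2).
Qed.

(** * Merging, sorting and the main procedure *)

(** In a step the lower half of the bits is the width, so the upper layers are applied to all
    positions of the block without an outer loop. *)
Inductive merge_plan (up : bool) : nat -> nat -> nat -> plan -> Prop :=
  | MergeLoopPlan base k l p1 p2 :
      merge_plan up base k l p1 ->
      merge_plan up (base + 2 ^ (k + l)) k l p2 ->
      merge_plan up base k l.+1 (PCall (PFork p1 p2))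
  | MergeSkipPlan base : merge_plan up base 0 0 (PCall PSkip)
  | MergeStepPlan base k p1 p2 :
      0 < k ->
      layers_plan up base (k %/ 2) (k - k %/ 2) (k %/ 2) 0 0 p1 ->
      merge_plan up base (k %/ 2) (k - k %/ 2) p2 ->
      merge_plan up base k 0 (PCall (PSeq p1 p2)).

Lemma merge_plan_exists up base k l : exists p, merge_plan up base k l p.
Proof.
elim/ltn_ind: k base l => k IHk base l.
elim: l base => [|l IHl] base; last first.
  have [p1 q1] := IHl base; have [p2 q2] := IHl (base + 2 ^ (k + l)).
  by eexists; apply: MergeLoopPlan q1 q2.
case: (posnP k) => [-> | k0]; first by eexists; apply: MergeSkipPlan.
have [|p1 q1] := @layers_plan_exists up base (k %/ 2) (k - k %/ 2) (k %/ 2) 0 0.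
  by lia.
have [|p2 q2] := IHk (k %/ 2) _ base (k - k %/ 2); first by lia.
by eexists; apply: MergeStepPlan q1 q2.
Qed.

Lemma free_bits_merge k : free_bits (k %/ 2) (k - k %/ 2) (k %/ 2) 0 0 = iota 0 k.
Proof. by rewrite /free_bits /= -{2}[k %/ 2]add0n -iotaD; congr iota; lia. Qed.

Lemma iota_loop k l : perm_eq (iota 0 (k + l.+1)) (k + l :: iota 0 (k + l)).
Proof. by rewrite addnS (iota_last 0). Qed.

Lemma clear_iota_loop K k l base : clear K (iota 0 (k + l.+1)) base ->
  clear K (iota 0 (k + l)) base && clear K (iota 0 (k + l)) (base + 2 ^ (k + l)).
Proof. by rewrite (clear_perm _ _ (iota_loop _ _)) => /clear_cons. Qed.

Lemma merge_plan_addresses up base k l p : merge_plan up base k l p ->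
  {subset addresses p <= cube (iota 0 (k + l)) base}.
Proof.
elim=> {base k l p} [base k l p1 p2 _ IH1 _ IH2|base|base k p1 p2 k0 q1 _ IH2] i //.
  rewrite (perm_mem (cube_perm _ (iota_loop _ _))) /= mem_cat.
  by rewrite (addresses_cat p1 p2) => /orP[/IH1-> //|/IH2->]; rewrite orbT.
have e : k %/ 2 + (k - k %/ 2) = k by lia.
rewrite (addresses_cat p1 p2) addn0 => /orP[/(layers_plan_addresses q1)|/IH2].
  by rewrite free_bits_merge.
by rewrite e.
Qed.

Lemma merge_plan_computes up K base k l p : merge_plan up base k l p ->
  clear K (iota 0 (k + l)) base ->
  computes (plan_net p) (cube (iota 0 (k + l)) base) up (rev (iota 0 k)).
Proof.
have closed k' l' b : clear K (iota 0 (k' + l')) b ->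
    {in rev (iota 0 k'), forall f, closed_under (cube (iota 0 (k' + l')) b) f}.
  move=> clr f; rewrite mem_rev !mem_iota => fk i; apply: cube_flip clr _.
  by rewrite mem_iota; lia.
elim=> {base k l p} [base k l p1 p2 _ IH1 _ IH2|base|base k p1 p2 k0 q1 _ IH2] clr.
- have /andP[c1 c2] := clear_iota_loop clr.
  rewrite (clear_perm _ _ (iota_loop _ _)) in clr.
  have p := cube_perm base (iota_loop k l).
  rewrite perm_sym in p; apply: (computes_perm p).
  apply: computes_union (IH1 c1) (IH2 c2); try exact: closed.
  by move=> i; apply: cube_disjoint clr.
- by move=> w; split=> // i /=; rewrite if_same.
have e : k %/ 2 + (k - k %/ 2) = k by lia.
move: (clr); rewrite addn0 -{1}free_bits_merge => c1.
rewrite addn0 -{1}e in clr; have := IH2 clr.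
have := layers_plan_computes q1 c1; rewrite free_bits_merge e => h1 h2.
rewrite -{2}e iotaD add0n rev_cat; apply: computes_seq h1 h2.
by have := closed _ _ _ clr; rewrite e.
Qed.

Definition merge_regs (up : bool) (base k l : nat) : seq (nat * nat) :=
  [:: (1, k); (2, base); (3, nat_of_bool (~~ up)); (8, l)].

Section MergeRegisters.
Variables (T : Type) (rho : nat -> value T) (up : bool) (base k l : nat).

Lemma merge_regs_inv :
  {in merge_regs up base k l, forall rv, rho rv.1 = Word rv.2} ->
  [/\ rho 1 = Word k, rho 2 = Word base, rho 3 = Word (~~ up) & rho 8 = Word l].
Proof.
move=> r; split; [apply: (r (1, k)) | apply: (r (2, base))
  | apply: (r (3, nat_of_bool (~~ up))) | apply: (r (8, l))];
  by rewrite !inE eqxx ?orbT.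
Qed.

Lemma merge_regs_intro :
  rho 1 = Word k -> rho 2 = Word base -> rho 3 = Word (~~ up) -> rho 8 = Word l ->
  {in merge_regs up base k l, forall rv, rho rv.1 = Word rv.2}.
Proof.
by move=> r1 r2 r3 r8 rv; rewrite !inE; do ![case/orP]; move/eqP->.
Qed.

End MergeRegisters.

Lemma merge_plan_implements up K base k l p : merge_plan up base k l p ->
  clear K (iota 0 (k + l)) base ->
  forall d, implements (2 ^ K) d 2 (merge_regs up base k l) p.
Proof.
have K_lt := ltn_expl K (ltnSn 1).
elim=> {base k l p} [base k l p1 p2 q1 IH1 q2 IH2|base|base k p1 p2 k0 q1 q2 IH2] clr d.
- have /andP[c1 c2] := clear_iota_loop clr.
  have slk : k + l.+1 <= K.
    by rewrite -[_ + _]add0n; apply: (clear_iota_le (m := 0) clr) => //; rewrite addnS.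
  have bk : base < 2 ^ K by case/and3P: c1.
  have bk2 : base + 2 ^ (k + l) < 2 ^ K by case/and3P: c2.
  have [D1 F1 E1] := IH1 c1 d.+2; have [D2 F2 E2] := IH2 c2 d.+2.
  rewrite (clear_perm _ _ (iota_loop _ _)) in clr.
  have dis : {in addresses p1, forall i, i \notin addresses p2}.
    move=> i /(merge_plan_addresses q1) /(cube_disjoint clr).
    exact/contra/(merge_plan_addresses q2).
  eexists; last first.
    move=> disp T W rho mu HW el regs.
    have [r1 r2 r3 r8] := merge_regs_inv regs.
    eapply exec_call_eq.
    + rewrite -[nth _ _ _]/merge_code /merge_code; branch l.+1; assign l.
      eapply exec_fork.
        by apply: E1 => //; apply: merge_regs_intro.
      assign (base + 2 ^ (k + l)).
      apply: E2 => //; first exact: all_elems_after.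
      by apply: merge_regs_intro.
    + by rewrite heap_after_cat.
    by rewrite heap_gates_cat.
  solve_follows F1 F2.
  by have := par_race_free d.+1 F1 F2 dis; rewrite /= !dagE !andbT => ->.
- eexists; last first.
    move=> disp T W rho mu HW el regs.
    have [r1 r2 r3 r8] := merge_regs_inv regs.
    eapply exec_call_eq.
    + rewrite -[nth _ _ _]/merge_code /merge_code; branch 0; branch 0.
      exact: exec_skip.
    + by [].
    by [].
  by split; rewrite /= ?dagE.
have e : k %/ 2 + (k - k %/ 2) = k by lia.
move: (clr); rewrite addn0 -{1}free_bits_merge => c1.
rewrite addn0 in clr.
have kK : k <= K by apply: (clear_iota_le (m := 0) clr).
have bk : base < 2 ^ K by case/and3P: clr.
rewrite -{1}e in clr.
have [D1 F1 E1] := layers_plan_implements q1 c1 d.+1.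
have [D2 F2 E2] := IH2 clr d.+1.
eexists; last first.
  move=> disp T W rho mu HW el regs.
  have [r1 r2 r3 r8] := merge_regs_inv regs.
  eapply exec_call_eq.
  + rewrite -[nth _ _ _]/merge_code /merge_code; branch 0; branch k.
    rewrite -lt0n k0.
    assign (k %/ 2); assign (k %/ 2); assign (k - k %/ 2); assign 0.
    eapply exec_seq; first by apply: E1 => //; apply: layers_regs_intro.
    assign (k %/ 2); assign (k - k %/ 2).
    apply: E2 => //; first exact: all_elems_after.
    by apply: merge_regs_intro.
  + by rewrite /= heap_after_cat.
  by rewrite /= heap_gates_cat.
solve_follows F1 F2.
by rewrite /= !dagE (follows_race_free F1) (follows_race_free F2).
Qed.

Inductive sort_plan : bool -> nat -> nat -> plan -> Prop :=
  | SortSkipPlan up base : sort_plan up base 0 (PCall PSkip)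
  | SortStepPlan up base k p1 p2 p3 :
      sort_plan up base k p1 -> sort_plan (~~ up) (base + 2 ^ k) k p2 ->
      merge_plan up base k.+1 0 p3 ->
      sort_plan up base k.+1 (PCall (PSeq (PFork p1 p2) p3)).

Lemma sort_plan_exists up base k : exists p, sort_plan up base k p.
Proof.
elim: k up base => [|k IH] up base; first by eexists; apply: SortSkipPlan.
have [p1 q1] := IH up base; have [p2 q2] := IH (~~ up) (base + 2 ^ k).
have [p3 q3] := merge_plan_exists up base k.+1 0.
by eexists; apply: SortStepPlan q1 q2 q3.
Qed.

Lemma clear_iotaS K k base : clear K (iota 0 k.+1) base ->
  clear K (iota 0 k) base && clear K (iota 0 k) (base + 2 ^ k).
Proof. by rewrite (clear_perm _ _ (iota_last _ _)) => /clear_cons. Qed.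

Lemma sort_plan_addresses up base k p : sort_plan up base k p ->
  {subset addresses p <= cube (iota 0 k) base}.
Proof.
elim=> {up base k p} [//|up base k p1 p2 p3 _ IH1 _ IH2 q3] i.
rewrite (addresses_cat (PFork p1 p2) p3) (addresses_cat p1 p2) => /orP[|].
  rewrite (perm_mem (cube_perm _ (iota_last _ _))) /= mem_cat.
  by case/orP => [/IH1->|/IH2->] //; rewrite orbT.
by move/(merge_plan_addresses q3); rewrite addn0.
Qed.

(** Program and network have the same recursion, and their merges compute the same layers on the
    same interval, though in a different order. *)
Lemma sort_plan_equiv K up base k p : sort_plan up base k p ->
  clear K (iota 0 k) base -> 2 ^ k %| base ->
  equiv_nets (plan_net p) (bitonic_sort up base k).
Proof.
elim=> {up base k p} [//|up base k p1 p2 p3 _ IH1 _ IH2 q3] clr kb.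
have /andP[c1 c2] := clear_iotaS clr.
have kb0 : 2 ^ k %| base by apply: dvdn_trans kb; rewrite dvdn_exp2l.
have kb1 : 2 ^ k %| base + 2 ^ k by rewrite dvdn_add.
rewrite bitonic_sortS.
rewrite -[plan_net _]/((plan_net p1 ++ plan_net p2) ++ plan_net p3) -catA.
apply: equiv_nets_cat; first exact: IH1.
apply: equiv_nets_cat; first exact: IH2.
apply: (computes_equiv _ (bitonic_merge_computes up kb)).
apply: (computes_perm (cube_iota _ _)).
by have := @merge_plan_computes up K _ _ _ _ q3; rewrite addn0 => h; apply: h clr.
Qed.

Definition sort_regs (up : bool) (base k : nat) : seq (nat * nat) :=
  [:: (1, k); (2, base); (3, nat_of_bool (~~ up))].

Lemma sort_plan_implements K up base k p : sort_plan up base k p ->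
  clear K (iota 0 k) base ->
  forall d, implements (2 ^ K) d 1 (sort_regs up base k) p.
Proof.
have K_lt := ltn_expl K (ltnSn 1).
have regs_inv (T : Type) (rho : nat -> value T) up' base' k' :
    {in sort_regs up' base' k', forall rv, rho rv.1 = Word rv.2} ->
    [/\ rho 1 = Word k', rho 2 = Word base' & rho 3 = Word (~~ up')].
  move=> r; split; [apply: (r (1, k')) | apply: (r (2, base'))
    | apply: (r (3, nat_of_bool (~~ up')))]; by rewrite !inE eqxx ?orbT.
have regs_intro (T : Type) (rho : nat -> value T) up' base' k' :
    rho 1 = Word k' -> rho 2 = Word base' -> rho 3 = Word (~~ up') ->
    {in sort_regs up' base' k', forall rv, rho rv.1 = Word rv.2}.
  by move=> r1 r2 r3 rv; rewrite !inE; do ![case/orP]; move/eqP->.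
elim=> {up base k p} [up base|up base k p1 p2 p3 q1 IH1 q2 IH2 q3] clr d.
  eexists; last first.
    move=> disp T W rho mu HW el regs.
    have [r1 r2 r3] := regs_inv _ _ _ _ _ regs.
    eapply exec_call_eq.
    + rewrite -[nth _ _ _]/sort_code /sort_code; branch 0.
      exact: exec_skip.
    + by [].
    by [].
  by split; rewrite /= ?dagE.
have /andP[c1 c2] := clear_iotaS clr.
have kK : k < K by apply: (clear_iota_le (m := 0) clr).
have bk : base < 2 ^ K by case/and3P: c1.
have bk2 : base + 2 ^ k < 2 ^ K by case/and3P: c2.
have [D1 F1 E1] := IH1 c1 d.+2; have [D2 F2 E2] := IH2 c2 d.+2.
have [|D3 F3 E3] := @merge_plan_implements up K base k.+1 0 p3 q3 _ d.+1.
  by rewrite addn0.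
rewrite (clear_perm _ _ (iota_last _ _)) in clr.
have dis : {in addresses p1, forall i, i \notin addresses p2}.
  move=> i /(sort_plan_addresses q1) /(cube_disjoint clr).
  exact/contra/(sort_plan_addresses q2).
have nb : nat_of_bool (~~ ~~ up) = 1 - ~~ up by case: (up).
eexists; last first.
  move=> disp T W rho mu HW el regs.
  have [r1 r2 r3] := regs_inv _ _ _ _ _ regs.
  eapply exec_call_eq.
  + rewrite -[nth _ _ _]/sort_code /sort_code; branch k.+1; assign k.
    eapply exec_seq.
      eapply exec_fork.
        by apply: E1 => //; apply: regs_intro.
      assign (base + 2 ^ k); assign (1 - ~~ up).
      apply: E2 => //; first exact: all_elems_after.
      by apply: regs_intro => //; rewrite nb.
    assign k.+1; assign 0.
    apply: E3 => //; first by do 2!apply: all_elems_after.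
    by apply: merge_regs_intro.
  + by rewrite /= !heap_after_cat.
  by rewrite /= ?cats0 !heap_gates_cat ?heap_after_cat -?catA.
split.
- rewrite /= !dagE; move: (follows_work F1) (follows_work F2) (follows_work F3); lia.
- rewrite /= !dagE; move: (follows_span F1) (follows_span F2) (follows_span F3); lia.
- have := par_race_free d.+1 F1 F2 dis.
  by rewrite /= !dagE (follows_race_free F3) !andbT => ->.
rewrite /= !dagE (follows_accesses F1) (follows_accesses F2).
by rewrite (follows_accesses F3) -?catA.
Qed.

(** The outermost body of [main_code] is in no call counted by the plan, hence the additive 20. *)
Record follows_main (d : nat) (p : plan) (D : dag) : Prop := FollowsMain {
  main_work : dag_work D <= 200 * plan_work p + 20;
  main_span : dag_span D <= 200 * plan_span p + 20;
  main_race_free : race_free D;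
  main_accesses : accesses D = plan_trace d p }.

(** Here [i] is the number of failing tests still to come; each of them adds a nested call around
    the sort. *)
Lemma main_exec k p : sort_plan true 0 k p -> forall i d, i <= k ->
  exists2 D, follows_main d (iter i PCall p) D &
    forall (disp : Order.disp_t) (T : orderType disp) (W : nat)
      (rho mu : nat -> value T),
    8 * 2 ^ k + 8 <= W -> all_elems (2 ^ k) mu ->
    rho 0 = Word (2 ^ k) -> rho 1 = Word (k - i) ->
    rho 2 = Word 0 -> rho 3 = Word 0 ->
    exists rho', exec W prog d main_code rho mu rho' (heap_after (plan_net p) mu) D
      (heap_gates (plan_net p) mu).
Proof.
have k_lt := ltn_expl k (ltnSn 1).
move=> q; elim=> [|i IH] d ik.
  have [|D F E] := sort_plan_implements q (K := k) _ d.
    by apply: clear_iota; rewrite ?dvdn0 ?expn_gt0.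
  eexists; last first.
    move=> disp T W rho mu HW el r0 r1 r2 r3; rewrite subn0 in r1.
    exists rho; branch 1.
    by apply: E => // rv; rewrite !inE; do ![case/orP]; move/eqP->.
  split; first by rewrite /=; move: (follows_work F); lia.
  - by rewrite /=; move: (follows_span F); lia.
  - by rewrite /= (follows_race_free F).
  by rewrite /= (follows_accesses F).
have [|D F E] := IH d.+1; first exact: ltnW.
eexists; last first.
  move=> disp T W rho mu HW el r0 r1 r2 r3.
  have pw : 2 ^ (k - i.+1) < 2 ^ k by rewrite ltn_exp2l //; lia.
  have [||||rho' E'] := E disp T W (upd rho 1 (Word (k - i))) mu HW el; try word.
  eexists; branch 0.
  eapply exec_seq with (gs1 := [::]) (gs2 := heap_gates (plan_net p) mu).
    by eapply exec_set with (v := k - i); solve_eval.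
  by apply: exec_call; exact: E'.
split.
- by rewrite /= !dagE; move: (main_work F); lia.
- by rewrite /= !dagE; move: (main_span F); lia.
- by rewrite /= !dagE (main_race_free F).
by rewrite /= !dagE (main_accesses F) -?catA.
Qed.

(** * Correctness of the program *)

Lemma init_heapE disp (T : orderType disp) n (x : n.-tuple T) (x0 : T) i :
  i < n -> init_heap x i = Elem (nth x0 x i) (Input i).
Proof.
move=> ik; have := onthTE x i; rewrite size_tuple ik /init_heap.
by case E: (onth x i) => [v|] // _; rewrite (@onth_nth _ x0 v _ _ E).
Qed.

Section Wires.
Variables (disp : Order.disp_t) (T : orderType disp) (x : nat -> T) (n : nat).

Definition holds (mu : nat -> value T) (w : nat -> wire) : Prop :=
  forall i, i < n -> mu i = Elem (wire_val x (w i)) (w i).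

Definition net_below (net : seq comparator) : Prop :=
  {in net, forall pq, pq.1 < n /\ pq.2 < n}.

Lemma holds_after net mu w : net_below net -> holds mu w ->
  holds (heap_after net mu) (wires_after net w) /\
  heap_gates net mu = gates_of net w.
Proof.
elim: net mu w => [|pq net IH] mu w // below h.
have [pn qn] := below _ (mem_head _ _).
rewrite run_network_cons.
have [||h' e] := IH (heap_step mu pq) (comp_step pq w) _ _.
- by move=> rs rsn; apply: below; rewrite inE rsn orbT.
- move=> i ik; rewrite /heap_step /comp_step /upd !h // /value_min /value_max.
  by case: eqP => // _; case: eqP => // _; rewrite h.
by split=> //=; rewrite e !h.
Qed.

Lemma perm_comp_step pq w : pq.1 < n -> pq.2 < n ->
  perm_eq [seq wire_val x (comp_step pq w i) | i <- iota 0 n]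
          [seq wire_val x (w i) | i <- iota 0 n].
Proof.
case: pq => p q /= pn qn; rewrite /comp_step /upd /=.
have [<- | pq] := eqVneq p q.
  (* If the ends of the comparator coincide, the maximum overwrites the minimum, and both equal the
     old value. *)
  rewrite (_ : map _ _ = [seq wire_val x (w i) | i <- iota 0 n]) //.
  by apply: eq_map => i /=; case: eqP => // ->; rewrite /= maxxx.
have [s p1 us] : exists2 s, perm_eq (iota 0 n) [:: p, q & s] & uniq [:: p, q & s].
  have qi : q \in rem p (iota 0 n).
    by rewrite (mem_rem_uniq _ (iota_uniq 0 n)) !inE eq_sym pq mem_iota.
  have p1 : perm_eq (iota 0 n) [:: p, q & rem q (rem p (iota 0 n))].
    apply: perm_trans (perm_to_rem (_ : p \in _)) _; first by rewrite mem_iota.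
    by rewrite perm_cons perm_to_rem.
  by exists (rem q (rem p (iota 0 n))); rewrite // -(perm_uniq p1) iota_uniq.
apply: perm_trans (perm_map _ p1) _; rewrite perm_sym.
apply: perm_trans (perm_map _ p1) _; rewrite perm_sym /= !eqxx (negbTE pq).
case/and3P: us; rewrite inE negb_or => /andP[_ ps] qs _.
set t1 := map _ s; have -> : t1 = [seq wire_val x (w i) | i <- s].
  apply/eq_in_map => i si /=; rewrite !ifN //.
    by apply: contraNneq ps => <-.
  by apply: contraNneq qs => <-.
rewrite -[_ :: _ :: map _ _]cat1s -[_ :: map _ _]cat1s catA perm_sym.
rewrite -[_ :: _ :: map _ _]cat1s -[_ :: map _ _]cat1s catA perm_cat2r perm_sym /=.
case: (leP (wire_val x (w p)) (wire_val x (w q))) => _ //.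
by rewrite (perm_catC [:: _] [:: _]).
Qed.

Lemma perm_wires_after net w : net_below net ->
  perm_eq [seq wire_val x (wires_after net w i) | i <- iota 0 n]
          [seq wire_val x (w i) | i <- iota 0 n].
Proof.
elim: net w => [|pq net IH] w below //.
have [pn qn] := below _ (mem_head _ _).
rewrite run_network_cons; apply: perm_trans (perm_comp_step w pn qn).
by apply: IH => rs rsn; apply: below; rewrite inE rsn orbT.
Qed.

End Wires.

(** As n + 1 is at least 2, its cube is at least 8. This is where the word exponent 4 comes from. *)
Lemma word_bound n : 0 < n -> 8 * n + 8 <= n.+1 ^ 4.
Proof. by move=> n0; rewrite -mulnSr expnSr leq_mul2r -[8]/(2 ^ 3) leq_exp2r. Qed.

Lemma sort_plan_below k p : sort_plan true 0 k p -> net_below (2 ^ k) (plan_net p).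
Proof.
move=> q pq pqp; have clr : clear k (iota 0 k) 0.
  by apply: clear_iota; rewrite ?dvdn0 ?expn_gt0.
have addr i : i \in [:: pq.1; pq.2] -> i < 2 ^ k.
  move=> ipq; apply: (cube_lt clr); apply: (sort_plan_addresses q).
  by apply/flattenP; exists [:: pq.1; pq.2] => //; apply: map_f.
by split; apply: addr; rewrite !inE eqxx ?orbT.
Qed.

Lemma program_run k p : sort_plan true 0 k p ->
  exists2 D, follows_main 0 (iter k PCall p) D &
    forall (disp : Order.disp_t) (T : orderType disp) (x : (2 ^ k).-tuple T),
    exists mu, [/\ run prog 4 x mu D (gates_of (plan_net p) Input) &
      forall i, i < 2 ^ k ->
        mu i = Elem (wire_val (nth (tnth x (Ordinal (expn2_gt0 k))) x) (bitonic_wires k i))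
                    (bitonic_wires k i)].
Proof.
move=> q; have [D F E] := main_exec q 0 (leqnn k); exists D => // disp T x.
set y := nth _ x.
have h : holds y (2 ^ k) (init_heap x) Input by move=> i ik; apply: init_heapE.
have [h' eg] := holds_after (sort_plan_below q) h.
have [||||||rho E'] := E disp T ((2 ^ k).+1 ^ 4) (init_regs T (2 ^ k)) (init_heap x).
- exact/word_bound/expn2_gt0.
- by move=> i ik; exists (y i), (Input i); rewrite h.
- by [].
- by rewrite subnn.
- by [].
- by [].
exists (heap_after (plan_net p) (init_heap x)); split.
  by exists rho; rewrite -eg.
move=> i ik; rewrite h' //.
have [|e _] := sort_plan_equiv (K := k) q _ (dvdn0 _) Input.
  by apply: clear_iota; rewrite ?dvdn0 ?expn_gt0.
by rewrite e.
Qed.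

(** Determinism of [exec] transfers the properties of the constructed run to every run. *)
Lemma run_det k p D : sort_plan true 0 k p -> dag_of prog 4 (2 ^ k) D ->
  follows_main 0 (iter k PCall p) D.
Proof.
move=> q; have [D' F E] := program_run q => -[disp [T [x [mu [gs [rho R]]]]]].
have [mu' [[rho' R'] _]] := E _ _ x.
by have [_ _ <- _] := exec_det R' R.
Qed.

Lemma program_sorts : sorts prog 4.
Proof.
move=> k disp T x; have [p q] := sort_plan_exists true 0 k.
have [D F E] := program_run q; have [mu [R out]] := E _ _ x.
set v := nth _ x in out.
pose y := [tuple wire_val v (bitonic_wires k i) | i < 2 ^ k].
exists mu, D, (gates_of (plan_net p) Input), y.
have ey : y = [seq wire_val v (bitonic_wires k i) | i <- iota 0 (2 ^ k)] :> seq T.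
  by rewrite /= -val_enum_ord -map_comp.
split=> //.
- by move=> i; rewrite out // tnth_mktuple; eexists.
- apply/(sortedP (v 0)) => i; rewrite ey size_map size_iota => ik.
  by rewrite !(nth_map 0) ?size_iota ?nth_iota ?bitonic_wires_sorted //; apply: ltnW.
have below := sort_plan_below q.
have := perm_wires_after v Input below; rewrite ey.
have [|e _] := sort_plan_equiv (K := k) q _ (dvdn0 _) Input.
  by apply: clear_iota; rewrite ?dvdn0 ?expn_gt0.
rewrite (eq_map (g := fun i => wire_val v (bitonic_wires k i))); last by move=> i; rewrite e.
move=> h; apply: perm_trans h _; rewrite /=.
by rewrite map_nth_iota0 ?size_tuple // take_oversize ?size_tuple.
Qed.

Lemma program_implements_bitonic_sort : implements_bitonic_sort prog 4.
Proof.
move=> k disp T x mu D gs [rho R]; have [p q] := sort_plan_exists true 0 k.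
have [D' F E] := program_run q; have [mu' [[rho' R'] out]] := E _ _ x.
have [_ <- _ <-] := exec_det R' R; split; last first.
  by move=> i; rewrite out //; eexists.
have [|_ g] := sort_plan_equiv (K := k) q _ (dvdn0 _) Input; last exact: g.
by apply: clear_iota; rewrite ?dvdn0 ?expn_gt0.
Qed.

Lemma program_without_races : without_races prog 4.
Proof.
move=> k disp T x mu D gs R; have [p q] := sort_plan_exists true 0 k.
have [|_ _ r _] := @run_det k p D q; last exact: r.
by exists disp, T, x, mu, gs.
Qed.

Lemma program_data_oblivious : data_oblivious prog 4.
Proof.
move=> k disp1 disp2 T1 T2 x1 x2 mu1 D1 gs1 mu2 D2 gs2 [rho1 R1] [rho2 R2].
have [p q] := sort_plan_exists true 0 k.
have [D F E] := program_run q.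
have [mu1' [[rho1' R1'] _]] := E _ _ x1; have [mu2' [[rho2' R2'] _]] := E _ _ x2.
by have [_ _ <- _] := exec_det R1' R1; have [_ _ <- _] := exec_det R2' R2.
Qed.

(** * Work, span and depth *)

(** The added 2 pays for the call and the fork or sequence of a parent, so the bound adds up over
    the two branches; it is attained by a single comparator. *)
Lemma layers_plan_work up base lo h w s l p : layers_plan up base lo h w s l p ->
  plan_work p + 2 <= 2 * h * 2 ^ (h + w + l).
Proof.
elim=> {base lo h w s l p} /= [base lo h w s l p1 p2 _ IH1 _ IH2
    |base lo h w s p1 p2 _ _ IH1 _ IH2|base lo s
    |base lo h w s p1 p2 h1 _ _ IH1 _ IH2] //.
- have -> : 2 ^ (h + w + l.+1) = 2 * 2 ^ (h + w + l) by rewrite -expnS addnS.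
  by nia.
- have -> : 2 ^ (h + w.+1 + 0) = 2 * 2 ^ (h + w + 0) by rewrite -expnS addnS.
  by nia.
move: IH1 IH2; rewrite addn0.
have -> : h - h %/ 2 + w + h %/ 2 = h + w by lia.
have -> : h %/ 2 + w + (h - h %/ 2) = h + w by lia.
have := leq_div h 2; move: (h %/ 2) => h2; nia.
Qed.

(** A layer split lowers [L] by one and costs O(h + w), which is O(h) because w <= 3 (h - 1)
    there. *)
Lemma layers_plan_span up base lo h w s l p L : layers_plan up base lo h w s l p ->
  h <= 2 ^ L -> plan_span p <= 2 * l + 2 * w + 11 * h * L + 2.
Proof.
move=> q; elim: q L => {base lo h w s l p} /= [base lo h w s l p1 p2 _ IH1 _ IH2
    |base lo h w s p1 p2 _ _ IH1 _ IH2|base lo s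
    |base lo h w s p1 p2 h1 wh _ IH1 _ IH2] L hL.
- by move: (IH1 L hL) (IH2 L hL); lia.
- by move: (IH1 L hL) (IH2 L hL); lia.
- by lia.
case: L hL => [|L]; first by lia.
rewrite expnS => hL.
have [] : plan_span p1 <= 2 * (h %/ 2) + 2 * w + 11 * (h - h %/ 2) * L + 2 /\
    plan_span p2 <= 2 * (h - h %/ 2) + 2 * w + 11 * (h %/ 2) * L + 2.
  by split; [apply: IH1 | apply: IH2]; lia.
have := leq_div h 2; move: (h %/ 2) => h2; nia.
Qed.

Lemma layers_plan_depth up base lo h w s l p : layers_plan up base lo h w s l p ->
  plan_depth p <= 2 * l + 2 * w + 3 * h.
Proof.
elim=> {base lo h w s l p} /= [base lo h w s l p1 p2 _ IH1 _ IH2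
    |base lo h w s p1 p2 _ _ IH1 _ IH2|base lo s
    |base lo h w s p1 p2 h1 _ _ IH1 _ IH2]; lia.
Qed.

Lemma merge_plan_work up base k l p : merge_plan up base k l p ->
  plan_work p + 2 <= 4 * k.+1 * 2 ^ (k + l).
Proof.
elim=> {base k l p} /= [base k l p1 p2 _ IH1 _ IH2|base|base k p1 p2 k0 q1 _ IH2] //.
  have -> : 2 ^ (k + l.+1) = 2 * 2 ^ (k + l) by rewrite -expnS addnS.
  by nia.
move: (layers_plan_work q1) IH2; rewrite !addn0.
have -> : k - k %/ 2 + k %/ 2 = k by lia.
have -> : k %/ 2 + (k - k %/ 2) = k by lia.
have := leq_div k 2; have := expn2_gt0 k; move: (k %/ 2) (2 ^ k) => h X; nia.
Qed.

Lemma merge_plan_span up base k l p L : merge_plan up base k l p ->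
  k <= 2 ^ L -> plan_span p <= 2 * l + 11 * k * L + 8 * k + 2.
Proof.
elim=> {base k l p} /= [base k l p1 p2 _ IH1 _ IH2|base|base k p1 p2 k0 q1 _ IH2] kL.
- by move: (IH1 kL) (IH2 kL); lia.
- by lia.
have h1 := @layers_plan_span _ _ _ _ _ _ _ _ L q1 ltac:(lia).
have h2 := IH2 ltac:(lia).
move: h1 h2; have : 2 * (k %/ 2) <= k by lia.
have : k <= 2 * (k %/ 2) + 1 by lia.
move: (k %/ 2) => h; nia.
Qed.

Lemma merge_plan_depth up base k l p : merge_plan up base k l p ->
  plan_depth p <= 2 * l + 5 * k + 1.
Proof.
elim=> {base k l p} /= [base k l p1 p2 _ IH1 _ IH2|base|base k p1 p2 k0 q1 _ IH2] //.
  by lia.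
by move: (layers_plan_depth q1); lia.
Qed.

Lemma sort_plan_work up base k p : sort_plan up base k p ->
  plan_work p + 3 <= 8 * k.+1 ^ 2 * 2 ^ k.
Proof.
elim=> {up base k p} /= [//|up base k p1 p2 p3 _ IH1 _ IH2 q3].
move: (merge_plan_work q3) IH1 IH2; rewrite addn0 expnS.
have := expn2_gt0 k; move: (2 ^ k) => X; rewrite -!mulnn; nia.
Qed.

Lemma sort_plan_span up base k p L : sort_plan up base k p ->
  k <= 2 ^ L -> plan_span p <= k * (11 * k * L + 8 * k + 5) + 2.
Proof.
elim=> {up base k p} /= [//|up base k p1 p2 p3 _ IH1 _ IH2 q3] kL.
move: (merge_plan_span q3 kL) (IH1 (ltnW kL)) (IH2 (ltnW kL)).
move: (plan_span p1) (plan_span p2) (plan_span p3) => s1 s2 s3.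
by nia.
Qed.

Lemma sort_plan_depth up base k p : sort_plan up base k p ->
  plan_depth p <= 5 * k + 2.
Proof.
elim=> {up base k p} /= [//|up base k p1 p2 p3 _ IH1 _ IH2 q3].
by move: (merge_plan_depth q3); lia.
Qed.

(** * Cache misses *)

(* Quantifying over the contents of the cache before and after s makes this
   bound additive in s. *)
Definition serves (c : nat) (s : seq loc) (m : nat) : Prop :=
  forall C, uniq C -> size C <= c -> exists C', [/\ uniq C', size C' <= c &
    forall s', opt_misses c C (s ++ s') <= m + opt_misses c C' s'].

Lemma bigminn_le (A : eqType) (r : seq A) (F : A -> nat) x a :
  a \in r -> \big[minn/x]_(i <- r) F i <= F a.
Proof.
elim: r => //= b r IH; rewrite inE big_cons => /orP[/eqP-> | /IH]; lia.
Qed.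

Lemma serves_misses c s m : serves c s m -> opt_misses c [::] s <= m.
Proof.
move=> /(_ [::] isT isT)[C [_ _ /(_ [::])]]; by rewrite cats0 addn0.
Qed.

Lemma serves_cat c s1 s2 m1 m2 :
  serves c s1 m1 -> serves c s2 m2 -> serves c (s1 ++ s2) (m1 + m2).
Proof.
move=> h1 h2 C u sC; have [C1 [u1 sC1 e1]] := h1 C u sC.
have [C2 [u2 sC2 e2]] := h2 C1 u1 sC1; exists C2; split=> // s'.
by rewrite -catA -addnA (leq_trans (e1 _)) // leq_add2l.
Qed.

(* Evicts only blocks outside S, which has room for all requests. *)
Lemma serves_subset c s S : {subset s <= S} -> size S <= c -> serves c s (size S).
Proof.
wlog uS : S / uniq S => [h sub sS | sub sS].
  have h1 : {subset s <= undup S} by move=> b /sub; rewrite mem_undup.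
  have sS' := leq_trans (size_undup S) sS.
  move=> C u sC; have [C' [u' sC' e]] := h _ (undup_uniq S) h1 sS' C u sC.
  by exists C'; split=> // s'; rewrite (leq_trans (e _)) // leq_add2r size_undup.
(* The potential is the number of blocks of [S] outside the cache; every miss lowers it. *)
suff main C : uniq C -> size C <= c -> exists C', [/\ uniq C', size C' <= c &
    forall s', opt_misses c C (s ++ s') <= count [predC C] S + opt_misses c C' s'].
  move=> C u sC; have [C' [u' sC' e]] := main C u sC; exists C'; split=> // s'.
  by rewrite (leq_trans (e _)) // leq_add2r count_size.
elim: s C sub => [|b s IH] C sub u sC; first by exists C; split=> // s'; exact: leq_addl.
have bS : b \in S by apply: sub; rewrite mem_head.
have {}sub : {subset s <= S} by move=> x xs; apply: sub; rewrite inE xs orbT.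
have [bC | bC] := boolP (b \in C).
  have [C' [u' sC' e]] := IH C sub u sC; exists C'; split=> // s'.
  by rewrite /= bC.
have [C1 [C1r sC1 u1 dec]] : exists C1, [/\ C1 \in replacements c C b, size C1 <= c,
    uniq C1 & (count [predC C1] S).+1 <= count [predC C] S].
  have dec C1 : b \in C1 -> {in rem b S, forall x, x \notin C1 -> x \notin C} ->
      (count [predC C1] S).+1 <= count [predC C] S.
    move=> bC1 h; rewrite !(permP (perm_to_rem bS)) /= bC1 bC /= !add0n ltnS.
    rewrite (@eq_in_count _ _ (predI [predC C1] [predC C])); last first.
      by move=> x xS /=; case: (boolP (x \in C1)) => //= /(h x xS)->.
    by apply: sub_count => x /andP[].
  rewrite /replacements; have [lt | ge] := ltnP (size C) c.
    exists (b :: C); rewrite mem_head /= bC; split=> //.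
    by apply: dec => [|x _]; rewrite ?mem_head // inE negb_or => /andP[].
  (* If all of the full cache were in [S], then [S], which also contains [b], would have more than
     [c] blocks. *)
  have [e eC eS] : exists2 e, e \in C & e \notin S.
    apply/allPn; apply: contraL ge => /allP CS; rewrite -ltnNge.
    apply: leq_trans sS; apply: (@uniq_leq_size _ (b :: C)); first by rewrite /= bC.
    by move=> x; rewrite inE => /orP[/eqP-> // | /CS].
  have C0 : 0 < size C by case: (C) eC.
  exists (b :: rem e C); split.
  - by apply/mapP; exists e.
  - by rewrite /= size_rem // prednK.
  - by rewrite /= rem_uniq // andbT; apply: contra bC => /mem_rem.
  apply: dec => [|x xS]; first by rewrite mem_head.
  rewrite inE negb_or (mem_rem_uniq _ u) !inE negb_and negbK => /andP[_ /orP[/eqP xe|//]].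
  by move: (mem_rem xS); rewrite xe (negbTE eS).
have [C' [u' sC' e]] := IH C1 sub u1 sC1; exists C'; split=> // s'.
rewrite /= (negbTE bC); apply: leq_trans (leq_add dec (leqnn _)).
rewrite addSn ltnS; apply: leq_trans (e s').
exact: (@bigminn_le _ _ (fun C' => opt_misses c C' (s ++ s')) _ _ C1r).
Qed.

Lemma serves_size c s : 0 < c -> serves c s (size s).
Proof.
move=> c0; elim: s => [|b s IH]; first by move=> C u sC; exists C.
rewrite -cat1s size_cat; apply: serves_cat IH.
exact: (@serves_subset _ _ [:: b]).
Qed.

(** * Misses of frames and of subproblems that fit into the cache *)

Section Cache.
Variables (M B : nat).
Hypotheses (B_gt0 : 0 < B) (tall : B ^ 2 <= M).

Definition plan_misses (d : nat) (p : plan) (m : nat) : Prop :=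
  serves (M %/ B) [seq block B l | l <- plan_trace d p] m.

Lemma cache_gt0 : 0 < M %/ B.
Proof. by rewrite divn_gt0 //; move: tall; rewrite -mulnn; nia. Qed.

Lemma frame_misses d : serves (M %/ B) [seq block B l | l <- frame prog d] 13.
Proof.
rewrite -(size_frame d) -(size_map (block B)); exact/serves_size/cache_gt0.
Qed.

(** Saving and restoring a frame are charged one miss for each of the 13 cells. *)
Lemma call_misses d p m : plan_misses d.+1 p m -> plan_misses d (PCall p) (m + 26).
Proof.
move=> h; rewrite /plan_misses trace_call !map_cat.
have -> : m + 26 = 13 + (m + 13) by lia.
by do 2?[apply: serves_cat => //]; apply: frame_misses.
Qed.

Lemma fork_misses d p1 p2 m1 m2 : plan_misses d.+1 p1 m1 -> plan_misses d.+1 p2 m2 ->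
  plan_misses d (PFork p1 p2) (m1 + m2 + 39).
Proof.
move=> h1 h2; rewrite /plan_misses trace_fork !map_cat.
have -> : m1 + m2 + 39 = 13 + (m1 + (13 + (m2 + 13))) by lia.
by do 4?[apply: serves_cat => //]; apply: frame_misses.
Qed.

Lemma seq_misses d p1 p2 m1 m2 : plan_misses d p1 m1 -> plan_misses d p2 m2 ->
  plan_misses d (PSeq p1 p2) (m1 + m2).
Proof.
by move=> h1 h2; rewrite /plan_misses trace_seq map_cat; apply: serves_cat.
Qed.

(** The summand 2 allows for partial blocks at both ends of an unaligned interval. *)
Definition block_cover (a len : nat) : seq nat := iota (a %/ B) (len %/ B + 2).

Lemma mem_block_cover a len i : a <= i < a + len -> i %/ B \in block_cover a len.
Proof.
case/andP=> ai il; rewrite mem_iota leq_div2r //=.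
rewrite ltn_divLR //; apply: leq_trans il _.
by have := ltn_ceil a B_gt0; have := ltn_ceil len B_gt0; nia.
Qed.

Lemma cube_cat fs1 fs2 base i : i \in cube (fs1 ++ fs2) base ->
  exists2 b, b \in cube fs1 base & i \in cube fs2 b.
Proof.
elim: fs1 base => [|f fs1 IH] base /=; first by exists base; rewrite ?inE.
by rewrite mem_cat => /orP[]/IH[b bf ib]; exists b; rewrite // mem_cat bf ?orbT.
Qed.

Lemma size_cube fs base : size (cube fs base) = 2 ^ size fs.
Proof.
by elim: fs base => //= f fs IH base; rewrite size_cat !IH expnS mul2n addnn.
Qed.

(** The cube consists of 2 ^ size hi runs of 2 ^ w adjacent cells. If the blocks of all runs and of
    the stack fit together, [serves_subset] charges each of them once. *)
Lemma fitting_misses d p hi w base :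
  {subset addresses p <= cube (hi ++ iota 0 w) base} ->
  let S := 2 ^ size hi * (2 ^ w %/ B + 2) + (13 * plan_depth p %/ B + 2) in
  S <= M %/ B -> plan_misses d p S.
Proof.
move=> sub S; set hs := flatten [seq map Heap (block_cover b (2 ^ w)) | b <- cube hi base].
set ss := map Stack (block_cover (13 * d) (13 * plan_depth p)).
have -> : S = size (hs ++ ss).
  rewrite size_cat size_map size_iota; congr (_ + _).
  rewrite /hs -(size_cube hi base); elim: (cube _ _) => //= b bs IH.
  by rewrite size_cat size_map size_iota -IH mulSn.
apply: serves_subset => _ /mapP[l lp ->]; rewrite mem_cat.
case: l lp => i ip /=; apply/orP; [left | right]; last first.
  apply: map_f; apply: mem_block_cover.
  by move: (stack_trace ip); rewrite mulnDr.
have [b bhi] := cube_cat (sub _ (heap_trace ip)).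
rewrite (perm_mem (cube_iota _ _)) mem_iota => ib.
apply/flattenP; exists (map Heap (block_cover b (2 ^ w))); first exact: map_f.
exact/map_f/mem_block_cover.
Qed.

(* Subproblems of 2 ^ mu positions fit into the cache. *)
Variable mu : nat.
Hypotheses (mu_ge3 : 3 <= mu) (M_ge : 2 ^ (mu + 13) <= M) (M_lt : M < 2 ^ (mu + 14)).

(** From B ^ 2 <= M < 2 ^ (mu + 14) <= 2 ^ (2 w + 16): runs of 2 ^ w cells are at most a constant
    factor shorter than a block. *)
Lemma block_bound w : mu <= 2 * w + 2 -> B <= 2 ^ 8 * 2 ^ w.
Proof.
move=> muw; rewrite -expnD -(leq_exp2r _ _ (ltn0Sn 1)) -expnM.
apply: leq_trans (leq_trans tall (ltnW M_lt)) _; rewrite leq_exp2l //; lia.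
Qed.

(* The 65 more misses pay for the 5 frame accesses of a parent that forks. *)
Lemma fitting_cost d p hi w base :
  {subset addresses p <= cube (hi ++ iota 0 w) base} ->
  size hi + w <= mu -> mu <= 2 * w + 2 -> plan_depth p <= 5 * (size hi + w) + 2 ->
  exists2 m, plan_misses d p m & B * (m + 65) <= 2 ^ 15 * 2 ^ (size hi + w).
Proof.
move=> sub fit /block_bound Bw depth.
set S := 2 ^ size hi * (2 ^ w %/ B + 2) + (13 * plan_depth p %/ B + 2).
have e_lt := ltn_expl (size hi + w) (ltnSn 1).
(* A run costs at most 2 ^ w + 2 B = O(2 ^ w) cells, and the stack is only linear in the exponent.
   The factor 2 ^ 11 stays below the 2 ^ 13 granted by [M_ge]. *)
have SB : S * B <= 2 ^ 11 * 2 ^ (size hi + w).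
  have d1 := leq_divM (2 ^ w) B; have d2 := leq_divM (13 * plan_depth p) B.
  move: Bw depth e_lt d1 d2; rewrite /S expnD.
  have := expn2_gt0 (size hi); have := expn2_gt0 w.
  move: (2 ^ w) (2 ^ size hi) (plan_depth p) => X Y pd.
  move: (X %/ B) (13 * pd %/ B) => q1 q2 X0 Y0 Bw depth e_lt d1 d2.
  have h1 : Y * (q1 * B) <= Y * X by rewrite leq_mul2l d1 orbT.
  have h2 : Y * B <= Y * (2 ^ 8 * X) by rewrite leq_mul2l Bw orbT.
  have h3 : X <= Y * X by rewrite leq_pmull.
  nia.
have fits : S <= M %/ B.
  rewrite leq_divRL //; apply: leq_trans SB (leq_trans _ M_ge).
  by rewrite -expnD leq_exp2l //; lia.
exists S; first exact: fitting_misses sub fits.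
have h3 : 2 ^ w <= 2 ^ (size hi + w) by rewrite leq_exp2l //; lia.
have -> : 2 ^ 15 = 2 ^ 11 * 2 ^ 4 by rewrite -expnD.
by move: SB Bw h3; move: (2 ^ (size hi + w)) (2 ^ w) => E X; lia.
Qed.

End Cache.

(** * Recursive bounds on the misses of layers, merges and the sort *)

Section CacheBounds.
Variables (M B mu : nat).
Hypotheses (B_gt0 : 0 < B) (tall : B ^ 2 <= M) (mu_ge3 : 3 <= mu).
Hypotheses (M_ge : 2 ^ (mu + 13) <= M) (M_lt : M < 2 ^ (mu + 14)).

Let fits := fitting_cost B_gt0 tall mu_ge3 M_ge M_lt.

(* The hypotheses on mu hold for all subproblems of a merge that does not fit
   into the cache: there 2 ^ w is at least of order sqrt M, and h of order log M. *)
Lemma layers_plan_misses up base lo h w s l p :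
  layers_plan up base lo h w s l p -> forall d,
  mu <= 2 * w + 2 -> mu <= 8 * h + 8 -> h <= w.+1 ->
  exists2 m, plan_misses M B d p m &
    mu * (B * (m + 65)) <= 2 ^ 19 * (h * 2 ^ (h + w + l)).
Proof.
(* A subproblem of at most 2 ^ mu positions is charged as a whole; mu <= 16 h' turns the factor [mu]
   into the number of layers. *)
have fit base' lo' h' w' s' l' p' d : layers_plan up base' lo' h' w' s' l' p' ->
    h' + w' + l' <= mu -> mu <= 2 * w' + 2 -> mu <= 8 * h' + 8 ->
    exists2 m, plan_misses M B d p' m &
      mu * (B * (m + 65)) <= 2 ^ 19 * (h' * 2 ^ (h' + w' + l')).
  move=> q e_mu mu_w mu_h; have h0 := layers_plan_h_gt0 q.
  have pp : perm_eq (free_bits lo' h' w' s' l')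
      ((iota s' l' ++ iota lo' h') ++ iota 0 w').
    by rewrite /free_bits -catA perm_cat2l perm_catC.
  have e : size (iota s' l' ++ iota lo' h') + w' = h' + w' + l'.
    by rewrite size_cat !size_iota; lia.
  have [|||| m pm mB] := @fits d p' (iota s' l' ++ iota lo' h') w' base'.
  - by move=> i /(layers_plan_addresses q); rewrite (perm_mem (cube_perm _ pp)).
  - by rewrite e.
  - by [].
  - by rewrite e; move: (layers_plan_depth q); lia.
  exists m => //; rewrite e in mB.
  have mu16 : mu <= 16 * h' by lia.
  apply: leq_trans (leq_mul mu16 mB) _.
  have -> : 2 ^ 19 = 2 ^ 15 * 2 ^ 4 by rewrite -expnD.
  move: (2 ^ 15) => Z; nia.
elim=> {base lo h w s l p} [base lo h w s l p1 p2 q1 IH1 q2 IH2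
    |base lo h w s p1 p2 hw q1 IH1 q2 IH2|base lo s
    |base lo h w s p1 p2 h1 wh q1 IH1 q2 IH2] d mu_w mu_h hw1.
- have [e_mu | mu_e] := leqP (h + w + l.+1) mu.
    by apply: fit e_mu mu_w mu_h; apply: LoopPlan q1 q2.
  have [m1 pm1 b1] := IH1 d.+2 mu_w mu_h hw1.
  have [m2 pm2 b2] := IH2 d.+2 mu_w mu_h hw1.
  eexists; first by apply: call_misses (fork_misses _ _ pm1 pm2).
  have -> : 2 ^ (h + w + l.+1) = 2 * 2 ^ (h + w + l) by rewrite -expnS addnS.
  by move: b1 b2; move: (2 ^ 19) => Z; nia.
- have [e_mu | mu_e] := leqP (h + w.+1 + 0) mu.
    by apply: fit e_mu mu_w mu_h; apply: WidthPlan q1 q2.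
  (* The cube does not fit, so mu <= h + w; together with 3 (h - 1) <= w this keeps the hypotheses
     for the smaller width. *)
  have [||| m1 pm1 b1] := IH1 d.+2; try lia.
  have [||| m2 pm2 b2] := IH2 d.+2; try lia.
  eexists; first by apply: call_misses (fork_misses _ _ pm1 pm2).
  have -> : 2 ^ (h + w.+1 + 0) = 2 * 2 ^ (h + w + 0) by rewrite -expnS addnS.
  by move: b1 b2; move: (2 ^ 19) => Z; nia.
- by apply: (fit _ _ _ _ _ _ _ d (CompPlan up base lo s)) => //; lia.
have [e_mu | mu_e] := leqP (h + w + 0) mu.
  by apply: (fit _ _ _ _ s _ _ d) e_mu mu_w mu_h; apply: LayerPlan q1 q2.
(* Here mu < h + w and w <= 3 (h - 1), so mu < 4 h and both halves of [h] are still of order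
   [mu]. *)
have [||| m1 pm1 b1] := IH1 d.+1; try lia.
have [||| m2 pm2 b2] := IH2 d.+1; try lia.
eexists; first by apply: call_misses (seq_misses pm1 pm2).
move: b1 b2; rewrite addn0.
have -> : h - h %/ 2 + w + h %/ 2 = h + w by lia.
have -> : h %/ 2 + w + (h - h %/ 2) = h + w by lia.
have := leq_div h 2; move: (2 ^ 19) (h %/ 2) => Z h2 hh b1 b2.
have -> : Z * (h * 2 ^ (h + w)) = Z * ((h - h2) * 2 ^ (h + w)) + Z * (h2 * 2 ^ (h + w)).
  by rewrite -mulnDr -mulnDl subnK.
apply: leq_trans (leq_add b1 b2).
by rewrite -mulnDr -mulnDr leq_mul2l leq_mul2l; lia.
Qed.

(** While a merge does not fit, mu < k gives mu <= 2 (k / 2) + 1, so the hypothesis survives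
    halving. Once it fits, mu <= 3 k lets the factor [k] pay for [mu]. *)
Lemma merge_plan_misses up base k l p : merge_plan up base k l p -> forall d,
  mu <= 2 * k + 1 ->
  exists2 m, plan_misses M B d p m &
    mu * (B * (m + 65)) <= 2 ^ 19 * (k * 2 ^ (k + l)).
Proof.
have fit base' k' l' p' d : merge_plan up base' k' l' p' ->
    k' + l' <= mu -> mu <= 2 * k' + 1 ->
    exists2 m, plan_misses M B d p' m &
      mu * (B * (m + 65)) <= 2 ^ 19 * (k' * 2 ^ (k' + l')).
  move=> q e_mu mu_k.
  have [|||| m pm mB] := @fits d p' [::] (k' + l') base'.
  - exact: merge_plan_addresses q.
  - by [].
  - by lia.
  - by move: (merge_plan_depth q); rewrite /=; lia.
  exists m => //; rewrite add0n in mB.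
  have mu3 : mu <= 3 * k' by lia.
  apply: leq_trans (leq_mul mu3 mB) _.
  have -> : 2 ^ 19 = 2 ^ 15 * 2 ^ 4 by rewrite -expnD.
  move: (2 ^ 15) => Z; nia.
elim=> {base k l p} [base k l p1 p2 q1 IH1 q2 IH2|base|base k p1 p2 k0 q1 q2 IH2] d mu_k.
- have [e_mu | mu_e] := leqP (k + l.+1) mu.
    by apply: fit e_mu mu_k; apply: MergeLoopPlan q1 q2.
  have [m1 pm1 b1] := IH1 d.+2 mu_k; have [m2 pm2 b2] := IH2 d.+2 mu_k.
  eexists; first by apply: call_misses (fork_misses _ _ pm1 pm2).
  have -> : 2 ^ (k + l.+1) = 2 * 2 ^ (k + l) by rewrite -expnS addnS.
  by move: b1 b2; move: (2 ^ 19) => Z; nia.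
- by lia.
have [e_mu | mu_e] := leqP (k + 0) mu.
  by apply: fit e_mu mu_k; apply: MergeStepPlan q1 q2.
have [||| m1 pm1 b1] := layers_plan_misses q1 d.+1; try lia.
have [| m2 pm2 b2] := IH2 d.+1; first by lia.
eexists; first by apply: call_misses (seq_misses pm1 pm2).
move: b1 b2; rewrite !(addn0, addn0 k).
have -> : k - k %/ 2 + k %/ 2 = k by lia.
have -> : k %/ 2 + (k - k %/ 2) = k by lia.
have := leq_div k 2; move: (2 ^ 19) (k %/ 2) => Z h2 hh b1 b2.
have -> : Z * (k * 2 ^ (k)) = Z * ((k - h2) * 2 ^ (k)) + Z * (h2 * 2 ^ (k)).
  by rewrite -mulnDr -mulnDl subnK.
apply: leq_trans (leq_add b1 b2).
by rewrite -mulnDr -mulnDr leq_mul2l leq_mul2l; lia.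
Qed.

(** At exponent [mu] a sort runs within the cache, which gives the summand [mu]. Each of the k - mu
    levels above it adds its merges. *)
Lemma sort_plan_misses up base k p : sort_plan up base k p -> forall d,
  mu <= k ->
  exists2 m, plan_misses M B d p m &
    mu * (B * (m + 65)) <= 2 ^ 19 * ((mu + (k - mu) * k) * 2 ^ k).
Proof.
elim=> {up base k p} [up base|up base k p1 p2 p3 q1 IH1 q2 IH2 q3] d mu_k; first by lia.
have [k_mu | mu_k'] := leqP k.+1 mu.
  have e : mu = k.+1 by lia.
  have q := SortStepPlan q1 q2 q3.
  have [||| m pm mB] := @fits d _ [::] k.+1 base (sort_plan_addresses q).
  - by rewrite /= add0n.
  - by lia.
  - exact: sort_plan_depth q.
  exists m => //; rewrite e subnn mul0n addn0; rewrite add0n in mB.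
  rewrite [X in _ <= X]mulnCA leq_mul2l; apply: leq_trans mB _.
  by rewrite leq_mul2r leq_exp2l // orbT.
have [m1 pm1 b1] := IH1 d.+2 mu_k'; have [m2 pm2 b2] := IH2 d.+2 mu_k'.
have [|m3 pm3 b3] := merge_plan_misses q3 d.+1; first by lia.
eexists; first by apply: call_misses (seq_misses (fork_misses _ _ pm1 pm2) pm3).
move: b3; rewrite addn0 (expnS 2 k) => b3.
have b12 := leq_add b1 b2; have b := leq_add b12 b3.
have -> : k.+1 - mu = (k - mu).+1 by lia.
apply: leq_trans (leq_trans _ b) _.
  by rewrite -!mulnDr leq_mul2l leq_mul2l; lia.
move: (2 ^ k) (k - mu) (2 ^ 19) => X t Z.
have h : (mu + t * k) * X + (mu + t * k) * X + k.+1 * (2 * X) <=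
    (mu + t.+1 * k.+1) * (2 * X).
  have -> : (mu + t * k) * X + (mu + t * k) * X + k.+1 * (2 * X) =
    (mu + t * k + k.+1) * (2 * X) by ring.
  by rewrite leq_mul2r mulSn mulnS; lia.
by rewrite -!(mulnDr Z) leq_mul2l h orbT.
Qed.

End CacheBounds.

(** * Costs of the program *)

Lemma iter_call_work i p : plan_work (iter i PCall p) = plan_work p + i.
Proof. by elim: i => [|i /= ->]; rewrite ?addn0 ?addnS. Qed.

Lemma iter_call_span i p : plan_span (iter i PCall p) = plan_span p + i.
Proof. by elim: i => [|i /= ->]; rewrite ?addn0 ?addnS. Qed.

Lemma size_accesses D : size (accesses D) <= dag_work D.
Proof. by elim: D => //= D1 IH1 D2 IH2; rewrite size_cat; lia. Qed.

Lemma sqrn_le_exp2 n : n * n <= 2 * 2 ^ n.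
Proof.
elim: n => // n IH; have := ltn_expl n (ltnSn 1); rewrite expnS.
by move: (2 ^ n) IH => X; nia.
Qed.

Section ProgramCosts.
Variables (k : nat) (D : dag).
Hypothesis dag_D : dag_of prog 4 (2 ^ k) D.

Lemma program_work : dag_work D <= 2000 * (k.+1 ^ 2 * 2 ^ k).
Proof.
have [p q] := sort_plan_exists true 0 k.
have := main_work (run_det q dag_D); rewrite iter_call_work.
have := sort_plan_work q; have := expn2_gt0 k; rewrite -mulnn.
by move: (2 ^ k) => X; nia.
Qed.

Lemma program_span L : k <= 2 ^ L -> dag_span D <= 3000 * (k.+1 ^ 2 * L.+1).
Proof.
move=> kL; have [p q] := sort_plan_exists true 0 k.
have := main_span (run_det q dag_D); rewrite iter_call_span.
have := sort_plan_span q kL; rewrite -mulnn.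
have -> : k * (11 * k * L + 8 * k + 5) = 11 * (k * k * L) + 8 * (k * k) + 5 * k by ring.
have -> : k.+1 * k.+1 * L.+1 = k * k * L + k * k + 2 * (k * L) + 2 * k + L + 1 by ring.
by move: (k * L) (k * k) (k * k * L); lia.
Qed.

(** One miss per access is a sufficient estimate for caches of bounded size. *)
Lemma program_misses_le_work M B : 0 < B -> B ^ 2 <= M -> cache_misses M B D <= dag_work D.
Proof.
move=> B0 tall; apply: leq_trans (size_accesses D).
rewrite -(size_map (block B)).
exact/serves_misses/serves_size/(cache_gt0 B0 tall).
Qed.

Lemma program_misses M B mu : 0 < B -> B ^ 2 <= M -> 3 <= mu ->
  2 ^ (mu + 13) <= M -> M < 2 ^ (mu + 14) -> M < 2 ^ k ->
  mu < k /\ mu * (B * cache_misses M B D) <= 2 ^ 21 * ((k - mu) * k * 2 ^ k).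
Proof.
move=> B0 tall mu3 M_ge M_lt M_k.
have mu_k : mu < k.
  by have := leq_ltn_trans M_ge M_k; rewrite ltn_exp2l //; lia.
split=> //; have [p q] := sort_plan_exists true 0 k.
have F := run_det q dag_D.
have cost d := sort_plan_misses B0 tall mu3 M_ge M_lt q d (ltnW mu_k).
(* The [k] nested calls of the main procedure add 26 misses each. *)
have [m pm bm] : exists2 m, plan_misses M B 0 (iter k PCall p) (m + 26 * k) &
    mu * (B * (m + 65)) <= 2 ^ 19 * ((mu + (k - mu) * k) * 2 ^ k).
  have gen i d : exists2 m, plan_misses M B d (iter i PCall p) (m + 26 * i) &
      mu * (B * (m + 65)) <= 2 ^ 19 * ((mu + (k - mu) * k) * 2 ^ k).
    elim: i d => [|i IH] d; first by have [m pm bm] := cost d; exists m; rewrite // addn0.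
    have [m pm bm] := IH d.+1; exists m => //.
    by rewrite mulnS addnCA addnC; apply: call_misses.
  exact: gen.
have misses : cache_misses M B D <= m + 26 * k.
  by rewrite /cache_misses (main_accesses F); apply: serves_misses.
(* Both mu ^ 2 and B ^ 2 are O(2 ^ k), hence so is the product. This absorbs the misses of the
   nested calls, with 78 = 3 * 26. *)
have muB : mu * B <= 3 * 2 ^ k.
  have := sqrn_le_exp2 mu; have : 2 ^ mu <= 2 ^ k by rewrite leq_exp2l // ltnW.
  move: tall M_k; rewrite -mulnn; move: (2 ^ mu) (2 ^ k) => X Y; nia.
have e21 : 2 ^ 21 = 2 ^ 19 * 4 by rewrite (expnD 2 19 2).
have Z_ge : 78 <= 2 ^ 19 by apply: (@leq_trans (2 ^ 7)); rewrite ?leq_exp2l.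
rewrite e21; move: bm misses muB Z_ge.
move: (2 ^ 19) (2 ^ k) (cache_misses _ _ _) => Z X cm bm misses muB Z78.
have h1 : mu * (B * cm) <= mu * (B * (m + 65)) + mu * B * (26 * k).
  by rewrite -mulnA -mulnDr leq_mul2l -mulnDr leq_mul2l; lia.
have h2 : mu * B * (26 * k) <= Z * (k * X).
  apply: leq_trans (leq_mul muB (leqnn _)) _.
  by apply: leq_trans (leq_mul Z78 (leqnn _)); nia.
(* Since mu < k, the in-cache summand [mu] is at most the summand for the levels above. *)
have h3 : mu + (k - mu) * k <= 2 * ((k - mu) * k).
  have : 1 * k <= (k - mu) * k by rewrite leq_mul2r; lia.
  by lia.
have h4 : (mu + (k - mu) * k) * X <= 2 * ((k - mu) * k) * X by rewrite leq_mul2r h3 orbT.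
have h5 : k * X <= (k - mu) * k * X.
  by rewrite leq_mul2r -{1}[k]mul1n leq_mul2r; lia.
have h6 : Z * ((mu + (k - mu) * k) * X) <= Z * (2 * ((k - mu) * k) * X).
  by rewrite leq_mul2l h4 orbT.
have h7 : Z * (k * X) <= Z * ((k - mu) * k * X) by rewrite leq_mul2l h5 orbT.
lia.
Qed.

End ProgramCosts.

(** * Real logarithms and the asymptotic bounds *)

Local Open Scope ring_scope.

Section Logarithms.
Variable R : realType.
Implicit Types (x y : R).

Lemma lg_ge1 x : 1 <= lg x.
Proof. by rewrite /lg le_max lexx. Qed.

Lemma lg_gt0 x : 0 < lg x.
Proof. exact: lt_le_trans ltr01 (lg_ge1 x). Qed.

Lemma ln2_gt0 : 0 < ln 2%:R :> R.
Proof. by rewrite ln_gt0 // ltr1n. Qed.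

Lemma lg_le x y : 0 < x -> x <= y -> lg x <= lg y.
Proof.
move=> x0 xy; rewrite /lg ge_max le_max lexx /= le_max ler_pM2r ?invr_gt0 ?ln2_gt0 //.
by rewrite ler_ln ?posrE ?xy ?orbT // (lt_le_trans x0).
Qed.

Lemma lg_exp2 n : lg (2%:R ^+ n : R) = Num.max 1 n%:R.
Proof. by rewrite /lg lnXn // mulrnAl divff // gt_eqF ?ln2_gt0. Qed.

Lemma lg_exp2_le (n : nat) : lg (2%:R ^+ n : R) <= n.+1%:R.
Proof. by rewrite lg_exp2 ge_max ler1n ler_nat leqnSn. Qed.

Lemma le_lg_exp2 n : n%:R <= lg (2%:R ^+ n : R).
Proof. by rewrite lg_exp2 le_max lexx orbT. Qed.

(** Compares 2 ^ k / M with 2 ^ (k - a). It turns the number of levels outside the cache into log (n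
    / M). *)
Lemma le_lg_ratio k a M : (0 < M)%N -> (M < 2 ^ a)%N ->
  k%:R <= lg (2%:R ^+ k / M%:R : R) + a%:R.
Proof.
move=> M0 Ma; have l1 := lg_ge1 (2%:R ^+ k / M%:R); have [ka | ak] := leqP k a.
  by have : k%:R <= a%:R :> R; [rewrite ler_nat | lra].
have M0' : 0 < M%:R :> R by rewrite ltr0n.
have : lg (2%:R ^+ (k - a) : R) <= lg (2%:R ^+ k / M%:R).
  apply: lg_le; first by rewrite exprn_gt0.
  rewrite ler_pdivlMr // -{2}(subnK (ltnW ak)) exprD ler_pM2l ?exprn_gt0 //.
  by rewrite -natrX ler_nat ltnW.
by have := le_lg_exp2 (k - a); rewrite natrB 1?ltnW //; lra.
Qed.

Lemma ler_mul_div (m B n lM C x y : R) : 0 < B -> 0 < lM ->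
  m * B * lM <= C * (n * (x * y)) -> m <= C * (n / B * (x / lM) * y).
Proof.
move=> B0 l0 h; have -> : C * (n / B * (x / lM) * y) = C * (n * (x * y)) / (B * lM).
  by field; rewrite !gt_eqF.
by rewrite ler_pdivlMr ?mulr_gt0 // (mulrA m).
Qed.

End Logarithms.

Theorem theorem3p2 (R : realType) :
  exists (P : program) (w : nat),
    [/\ sorts P w,
        implements_bitonic_sort P w,
        without_races P w,
        data_oblivious P w &
        exists C : R, forall (k : nat) (D : dag), dag_of P w (2 ^ k)%N D ->
          let n := (2 ^ k)%N in
          [/\ (dag_work D)%:R <= C * (n%:R * lg (n%:R : R) ^+ 2),
              (dag_span D)%:R <= C * (lg (n%:R : R) ^+ 2 * lg (lg (n%:R : R))) &
              forall M B : nat,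
                (0 < B)%N -> (B ^ 2 <= M)%N -> (M < n)%N ->
                (cache_misses M B D)%:R <=
                  C * (n%:R / B%:R * (lg (n%:R : R) / lg (M%:R : R))
                       * lg (n%:R / M%:R : R))]].
Proof.
exists prog, 4%N; split; [exact: program_sorts | exact: program_implements_bitonic_sort
  | exact: program_without_races | exact: program_data_oblivious |].
(* Caches below 2 ^ 16 count as small. The constants are hidden behind equations to stay symbolic in
   the arithmetic. *)
have [Z ZE] : exists Z : R, Z = 2%:R ^+ 16 by eexists.
have Z1 : 1 <= Z by rewrite ZE exprn_ege1 // ler1n.
have [a aE] : exists a : R, a = 2000%:R by eexists.
have [b bE] : exists b : R, b = 3000%:R by eexists.
have a0 : 0 <= a by rewrite aE ler0n.
have b0 : 0 <= b by rewrite bE ler0n.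
have aZ : a <= a * Z by rewrite ler_peMr.
(* The four bounds serve the work, the span, and the misses of small and of large caches. *)
have [C [aC bC azC ZC]] : exists C, [/\ 4 * a <= C, 12 * b <= C,
    4 * 17 * 17 * (a * Z) <= C & 6 * 32 * 15 * Z <= C].
  by exists (4 * 17 * 17 * (a * Z) + 12 * b + 6 * 32 * 15 * Z); split; lra.
exists C => k D dag_D n.
have nE : n%:R = 2%:R ^+ k :> R by rewrite natrX.
have n1 : 1 <= n%:R :> R by rewrite nE exprn_ege1 // ler1n.
have n0 : 0 <= n%:R :> R by exact: ler0n.
set l := lg n%:R; have l1 : 1 <= l := lg_ge1 _.
have l0 : 0 <= l := le_trans ler01 l1.
have kl : k%:R <= l by rewrite /l nE le_lg_exp2.
have k1l : k.+1%:R ^+ 2 <= 4 * l ^+ 2.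
  have -> : 4 * l ^+ 2 = (2 * l) ^+ 2 by ring.
  by rewrite lerXn2r ?nnegrE ?mulr_ge0 // -natr1; lra.
have work : (dag_work D)%:R <= 4 * a * (n%:R * l ^+ 2).
  have := program_work dag_D; rewrite -(ler_nat R) => /le_trans; apply.
  rewrite natrM natrM natrX -/n -aE.
  have -> : 4 * a * (n%:R * l ^+ 2) = a * (4 * l ^+ 2 * n%:R) by ring.
  by rewrite ler_wpM2l // ler_wpM2r.
split.
- by apply: le_trans work _; rewrite ler_wpM2r // mulr_ge0 // exprn_ge0.
- pose L := up_log 2 k; have kL : (k <= 2 ^ L)%N by apply: up_logP.
  have := program_span dag_D kL; rewrite -(ler_nat R) => /le_trans; apply.
  rewrite natrM natrM natrX -bE.
  have ll1 : 1 <= lg l := lg_ge1 _; have ll0 := ltW (lg_gt0 l).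
  (* For positive [L], 2 ^ (L - 1) < k <= l gives L - 1 <= lg l, and the remaining 2 is at most 2 lg
     l. *)
  have Ll : L.+1%:R <= 3 * lg l.
    case: (leqP k 1) => k_1.
      have -> : L = 0%N by rewrite /L; case: (k) k_1 => [|[]].
      by lra.
    have L0 : (0 < L)%N by rewrite /L up_log_gt0.
    have kL' : 2%:R ^+ L.-1 <= l.
      by apply: le_trans kl; rewrite -natrX ler_nat ltnW // up_log_gtn.
    have := le_trans (le_lg_exp2 R L.-1) (lg_le (exprn_gt0 L.-1 (ltr0Sn R 1)) kL').
    by rewrite -[in L.+1%:R](prednK L0) -[_.+2]addn2 natrD; lra.
  apply: (@le_trans _ _ (12 * b * (l ^+ 2 * lg l))); last first.
    by rewrite ler_wpM2r // mulr_ge0 // exprn_ge0.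
  have -> : 12 * b * (l ^+ 2 * lg l) = b * (4 * l ^+ 2 * (3 * lg l)) by ring.
  by rewrite ler_wpM2l // ler_pM // exprn_ge0.
move=> M B B0 tall M_n; rewrite -/l.
have M0 : (0 < M)%N by apply: leq_trans tall; rewrite expn_gt0 B0.
set r := lg (n%:R / M%:R); have r1 : 1 <= r := lg_ge1 _.
have r0 : 0 <= r := le_trans ler01 r1.
have nlr0 : 0 <= n%:R * (l * r) by rewrite !mulr_ge0.
have B0' : 0 < B%:R :> R by rewrite ltr0n.
have lM0 : 0 < lg M%:R :> R := lg_gt0 _.
apply: ler_mul_div => //.
(* For a small cache [B] and lg M are bounded and lg n is at most 17 lg (n / M), so the work bound
   suffices. *)
have [M_big | M_small] := leqP (2 ^ 16) M; last first.
  have lM : lg M%:R <= 17 :> R.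
    apply: le_trans (lg_exp2_le R 16); apply: lg_le; first by rewrite ltr0n.
    by rewrite -natrX ler_nat ltnW.
  have l_r : l <= 17 * r.
    have := le_lg_ratio R k M0 M_small; rewrite -nE -/r => h.
    by rewrite /l nE lg_exp2 ge_max; apply/andP; split; lra.
  have BZ : B%:R <= Z.
    rewrite ZE -natrX ler_nat; apply: leq_trans (ltnW M_small).
    by apply: leq_trans tall; rewrite -mulnn leq_pmulr.
  have misses : (cache_misses M B D)%:R <= 4 * a * (n%:R * l ^+ 2).
    by apply: le_trans work; rewrite ler_nat; exact: program_misses_le_work.
  have l2 : n%:R * l ^+ 2 <= n%:R * (l * (17 * r)).
    by rewrite expr2 ler_wpM2l // ler_wpM2l.
  have {}misses : (cache_misses M B D)%:R <= 4 * a * (n%:R * (l * (17 * r))).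
    by apply: le_trans misses _; rewrite ler_wpM2l // mulr_ge0.
  have {}misses : (cache_misses M B D)%:R * B%:R * lg M%:R <=
      4 * a * (n%:R * (l * (17 * r))) * Z * 17.
    apply: ler_pM => //; [by rewrite mulr_ge0 // ltW | exact: ltW |].
    by apply: ler_pM => //; exact: ltW.
  apply: le_trans misses _.
  have -> : 4 * a * (n%:R * (l * (17 * r))) * Z * 17 =
    4 * 17 * 17 * (a * Z) * (n%:R * (l * r)) by ring.
  by rewrite ler_wpM2r.
have : (16 <= trunc_log 2 M)%N by apply: trunc_log_max.
have := trunc_logP (ltnSn 1) M0; have := trunc_log_ltn M (ltnSn 1).
move: (trunc_log 2 M) => t M_t t_M t16 {M_big}.
(* The threshold 2 ^ 16 is what makes [mu], the integer logarithm of [M] minus 13, at least 3. *)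
have [mu mu3 tE] : exists2 mu, (3 <= mu)%N & t = (mu + 13)%N.
  exists (t - 13)%N; first exact: (@leq_sub2r 13%N 16%N t).
  by rewrite subnK // (leq_trans _ t16).
rewrite tE -addnS in M_t; rewrite tE in t_M.
have [mu_k misses] := program_misses dag_D B0 tall mu3 t_M M_t M_n.
have mu3' : 3 <= mu%:R :> R by rewrite ler_nat.
(* From lg M <= mu + 15 and 15 <= 5 mu. *)
have lM : lg M%:R <= 6 * mu%:R :> R.
  have : lg M%:R <= (mu + 14).+1%:R :> R.
    apply: le_trans (lg_exp2_le R _); apply: lg_le; first by rewrite ltr0n.
    by rewrite -natrX ler_nat ltnW.
  by rewrite -natr1 natrD; lra.
have k_mu : (k - mu)%:R <= 15 * r.
  by have := le_lg_ratio R k M0 M_t; rewrite -nE -/r natrB 1?ltnW // natrD; lra.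
have {}misses : mu%:R * (B%:R * (cache_misses M B D)%:R) <= 32 * Z * (15 * r * l * n%:R).
  have : (2 ^ 21)%:R = 32 * Z by rewrite natrX ZE (exprD _ 5 16) -natrX.
  move: misses; move: (2 ^ 21)%N => N misses NE.
  move: misses; rewrite -(ler_nat R) !natrM NE => /le_trans; apply.
  rewrite ler_wpM2l ?mulr_ge0 //; first by lra.
  by rewrite ler_wpM2r // ler_pM.
apply: (@le_trans _ _ (6 * (mu%:R * (B%:R * (cache_misses M B D)%:R)))).
  rewrite [leRHS](_ : _ = (cache_misses M B D)%:R * B%:R * (6 * mu%:R)); last by ring.
  by rewrite ler_wpM2l // mulr_ge0 // ltW.
apply: (@le_trans _ _ (6 * (32 * Z * (15 * r * l * n%:R)))); first by rewrite ler_wpM2l.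
have -> : 6 * (32 * Z * (15 * r * l * n%:R)) = 6 * 32 * 15 * Z * (n%:R * (l * r)) by ring.
by rewrite ler_wpM2r.
Qed.
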